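(* For every $\alpha \in (0,1]$ we have $$\lim_{n\to\infty} \mathrm{TV}\left(\alpha\text{-}\mathrm{CUA}(n),\ \mathrm{UA}(n)^{\otimes 2}\right) = 1 .$$
   Context: Uniform attachment (UA) tree: $T_0$ is a single node labeled $0$; given $T_{n-1}$ on nodes $\{0,\dots,n-1\}$, $T_n$ is obtained by adding a node labeled $n$ together with an edge from it to a node of $\{0,\dots,n-1\}$ chosen uniformly at random (independently of the past). $\mathrm{UA}(n)$ is the law of the unlabeled tree (isomorphism class, labels forgotten) of $T_n$. Correlated UA trees with parameter $\alpha\in[0,1]$: two trees $(T_n^1,T_n^2)_{n\ge 0}$ are grown together, both starting from a single node labeled $0$. At each step $n\ge1$, independently of the past: with probability $\alpha$ (''aligned choice'') a single $i\in\{0,\dots,n-1\}$ is chosen uniformly at random and the new node $n$ is connected to node $i$ in both trees; with probability $1-\alpha$ (''independent choice'') $i_1,i_2\in\{0,\dots,n-1\}$ are chosen independently and uniformly, and the new node $n$ is connected to $i_1$ in the first tree and to $i_2$ in the second tree. $\alpha\text{-}\mathrm{CUA}(n)$ is the law of the resulting pair of unlabeled trees (both trees have their labels forgotten). $\mathrm{UA}(n)^{\otimes 2}=0\text{-}\mathrm{CUA}(n)$ is the law of two independent unlabeled $\mathrm{UA}(n)$ trees. For probability measures $P,Q$ on a discrete set $\mathcal X$, $\mathrm{TV}(P,Q)=\sup_{A\subseteq\mathcal X}|P(A)-Q(A)|$. *)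

(* Defs.v *)
From HB Require Import structures.
From mathcomp Require Import all_boot all_order all_algebra all_fingroup.
From mathcomp Require Import all_classical all_reals all_analysis.

Set Implicit Arguments.
Unset Strict Implicit.
Unset Printing Implicit Defensive.

Import Order.TTheory GRing.Theory Num.Theory.
Import numFieldNormedType.Exports.

Local Open Scope ring_scope.

(* A law on a finite type is given by its mass function. *)
Notation law R T := {ffun T -> R}.

Section FiniteLaws.
Variable R : realType.

Definition lret (T : finType) (x : T) : law R T := [ffun y => (y == x)%:R].

Definition lbind (S T : finType) (p : law R S) (k : S -> law R T) : law R T :=
  [ffun y => \sum_(x : S) p x * k x y].

Definition lmap (S T : finType) (f : S -> T) (p : law R S) : law R T :=
  lbind p (fun x => lret (f x)).

Definition lunif (T : finType) : law R T := [ffun _ => (#|T|%:R)^-1].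

Definition lmix (T : finType) (a : R) (p q : law R T) : law R T :=
  [ffun y => a * p y + (1 - a) * q y].

Definition lprod (S T : finType) (p : law R S) (q : law R T) : law R (S * T)%type :=
  [ffun xy => p xy.1 * q xy.2].

Definition lprob (T : finType) (p : law R T) (A : {set T}) : R :=
  \sum_(x in A) p x.

Definition TV (T : finType) (p q : law R T) : R :=
  sup [set `|lprob p A - lprob q A| | A in [set: {set T}]]%classic.

End FiniteLaws.

(* A graph with vertex set 'I_m is given by its set of edges, an edge being the
   pair of its endpoints. *)
Definition graph (m : nat) := {set {set 'I_m}}.

Definition relabel (m m' : nat) (f : 'I_m -> 'I_m') (G : graph m) : graph m' :=
  [set f @: (e : {set 'I_m}) | e in G].

Definition isomorphic (m : nat) (G H : graph m) : bool :=
  [exists s : {perm 'I_m}, relabel s G == H].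

(* The unlabeled graph underlying G is its isomorphism class, as a set of graphs
   on 'I_m.  No vertex is distinguished: the classes are unrooted. *)
Definition unlabeled (m : nat) (G : graph m) : {set graph m} :=
  [set H : graph m | isomorphic G H].

(* The node added to the nodes {0, ..., m-1} carries the label m, i.e. ord_max. *)
Definition attach (m : nat) (G : graph m) (i : 'I_m) : graph m.+1 :=
  [set ord_max; widen_ord (leqnSn m) i] |: relabel (widen_ord (leqnSn m)) G.

Section UniformAttachment.
Variable R : realType.

(* T_n has node set {0, ..., n}. *)
Fixpoint labeled_UA (n : nat) : law R (graph n.+1) :=
  if n is m.+1 then
    lbind (labeled_UA m) (fun G =>
    lbind (lunif R 'I_m.+1) (fun i =>
    lret R (attach G i)))
  else lret R (finset.set0 : graph 1).

Definition UA (n : nat) : law R {set graph n.+1} :=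
  lmap (@unlabeled n.+1) (labeled_UA n).

Fixpoint labeled_CUA (alpha : R) (n : nat) : law R (graph n.+1 * graph n.+1)%type :=
  if n is m.+1 then
    lbind (labeled_CUA alpha m) (fun G =>
    lmix alpha
      (lbind (lunif R 'I_m.+1) (fun i =>
       lret R (attach G.1 i, attach G.2 i)))
      (lbind (lunif R 'I_m.+1) (fun i1 =>
       lbind (lunif R 'I_m.+1) (fun i2 =>
       lret R (attach G.1 i1, attach G.2 i2)))))
  else lret R ((finset.set0, finset.set0) : graph 1 * graph 1).

Definition CUA (alpha : R) (n : nat) :
    law R ({set graph n.+1} * {set graph n.+1})%type :=
  lmap (fun G => (unlabeled G.1, unlabeled G.2)) (labeled_CUA alpha n).

End UniformAttachment.

(* Main.v *)
(** Read an attachment sequence as independent uniform choices: the two trees of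
    a correlated pair are then two [alpha]-correlated copies of one product space,
    so E[F(T1) F(T2)] >= E[F]^2 for every F, and every martingale increment that is
    correlated with its own choice gives a positive covariance between the trees.

    For a fixed scale k, the expected number of non-root nodes of T_n that have a
    descendant among the next k nodes is a sum over nodes of 1 - miss k n s, with s
    the size of the subtree of the node.  Subtree sizes are Polya urns, so after
    centring this is a martingale in n, whose increments are at most 1 and mostly
    come from the times of order k.  Its variance is O(k), its fourth moment is
    controlled, and its covariance between the two trees is at least of order
    alpha k, since attaching to an old node moves it less than attaching to a
    typical one.  It can be read off the unlabeled tree up to an L2 error of order
    one, as a sum over edges of a function of the sizes of the two sides.

    Taking K scales, each much larger than the square of the time at which the
    previous ones are essentially determined, one obtains K nearly independent
    tests, each with a covariance bounded below under the correlated law and zero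
    under the product law.  Chebyshev's inequality for the sum of the K products
    separates the two laws as K grows. *)

Require Import Defs.
From mathcomp Require Import all_boot all_order all_algebra all_fingroup.
From mathcomp Require Import all_classical all_reals all_analysis.
From mathcomp Require Import zify ring lra.
Set Implicit Arguments.
Unset Strict Implicit.
Unset Printing Implicit Defensive.
Import Order.TTheory GRing.Theory Num.Theory.
Import numFieldNormedType.Exports.
Local Open Scope ring_scope.

(** * Attachment histories and subtree sizes *)

(* A history lists the attachment choices, newest first, of a process started with
   [b] nodes: in [i :: h], the new node has label [b + size h] and parent [i].  The
   initial nodes are not tracked, so that [anc b h u v] requires [b <= u]; with
   [b = 1] only the root is left out. *)
Fixpoint wf (b : nat) (h : seq nat) : bool :=
  if h is i :: h' then (i < b + size h')%N && wf b h' else true.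

Fixpoint anc (b : nat) (h : seq nat) (u v : nat) : bool :=
  if h is i :: h' then
    if v == (b + size h')%N then (u == v) || anc b h' u i else anc b h' u v
  else false.

(** Labels outside [b <= v < b + size h] get the dummy value 0. *)
Fixpoint par (b : nat) (h : seq nat) (v : nat) : nat :=
  if h is i :: h' then if v == (b + size h')%N then i else par b h' v else 0%N.

Definition sz (b : nat) (h : seq nat) (u : nat) : nat :=
  (\sum_(0 <= v < b + size h) anc b h u v)%N.

Section Forest.
Local Open Scope nat_scope.
Implicit Types (b i u v w : nat) (h : seq nat).

Lemma anc_range b h u v : wf b h -> anc b h u v ->
  [/\ b <= u, u <= v & v < b + size h].
Proof.
elim: h u v => [|i h IH] u v //= /andP[hi wh].
case: eqVneq => [->|nv].
  case/orP => [/eqP->|/(IH _ _ wh)[]]; first by split; lia.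
  by move=> *; split; lia.
by move=> /(IH _ _ wh)[*]; split; lia.
Qed.

Lemma anc_new_label b h u v : wf b h -> b + size h <= u -> anc b h u v = false.
Proof. by move=> wh hu; apply/negP => /(anc_range wh)[]; lia. Qed.

Lemma anc_self b h v : b <= v < b + size h -> anc b h v v.
Proof.
elim: h => [|i h IH] /=; first lia.
by move=> hv; case: eqVneq => [_|nv]; rewrite ?eqxx // IH //; lia.
Qed.

Lemma anc_trans b h u v w : wf b h -> anc b h u v -> anc b h v w -> anc b h u w.
Proof.
elim: h u v w => [|i h IH] u v w //= /andP[hi wh].
case: (eqVneq w (b + size h)) => [->|nw].
  case: (eqVneq v (b + size h)) => [->//|nv] huv.
  by move=> /orP[/eqP|hv] //; rewrite (IH _ _ _ wh huv hv) orbT.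
move=> huv hvw; have [_ h1 h2] := anc_range wh hvw.
move: huv; rewrite ifN; last by apply/eqP; lia.
by move=> huv; apply: IH hvw.
Qed.

(** Each node has a single parent, so the ancestors of [i] are totally ordered by [anc]; labels grow
    along paths, so comparing labels decides the direction. *)
Lemma anc_chain b h u w i : wf b h -> anc b h u i -> anc b h w i -> u <= w ->
  anc b h u w.
Proof.
elim: h u w i => [|p h IH] u w i //= /andP[hp wh].
case: (eqVneq i (b + size h)) => [->|ni] hu hw uw; last first.
  have huw := IH _ _ _ wh hu hw uw; rewrite ifN //.
  by have [_ ? ?] := anc_range wh hw; apply/eqP; lia.
case/orP: hw => [/eqP->|hw]; first by rewrite eqxx.
have [_ ? ?] := anc_range wh hw.
rewrite ifN; last by apply/eqP; lia.
case/orP: hu => [/eqP ?|hu]; first lia.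
exact: IH hw uw.
Qed.

Lemma par_lt b h v : wf b h -> b <= v < b + size h -> par b h v < v.
Proof.
elim: h => [|i h IH] /=; first lia.
move=> /andP[hi wh] hv; case: eqVneq => [->//|nv]; apply: IH => //; lia.
Qed.

Lemma anc_par b h u v : wf b h -> b <= v < b + size h ->
  anc b h u v = (u == v) || anc b h u (par b h v).
Proof.
elim: h u v => [|i h IH] u v /=; first lia.
move=> /andP[hi wh] hv; case: (eqVneq v (b + size h)) => [e|nv].
  by rewrite [i == _]ltn_eqF.
have hv' : b <= v < b + size h by lia.
have pv := par_lt wh hv'.
by rewrite (IH u v wh hv') ifN //; apply/eqP; lia.
Qed.

Lemma sz_cons b h i u : wf b (i :: h) ->
  sz b (i :: h) u = sz b h u + ((u == b + size h) || anc b h u i).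
Proof.
move=> /= /andP[hi wh]; rewrite /sz /= addnS big_nat_recr //= eqxx; congr (_ + _).
by apply: eq_big_nat => v /andP[_ hv]; rewrite ltn_eqF.
Qed.

Lemma sz_new_label b h u : wf b h -> b + size h <= u -> sz b h u = 0.
Proof. by move=> wh hu; rewrite /sz big1 // => v _; rewrite anc_new_label. Qed.

Lemma sz_cons_new b h i : wf b (i :: h) -> sz b (i :: h) (b + size h) = 1.
Proof.
by move=> wh; case/andP: (wh) => _ wh'; rewrite sz_cons // eqxx sz_new_label.
Qed.

Lemma sz_cons_old b h i u : wf b (i :: h) -> u < b + size h ->
  sz b (i :: h) u = sz b h u + anc b h u i.
Proof. by move=> wh hu; rewrite sz_cons // ltn_eqF. Qed.

Lemma sz_gt0 b h u : b <= u < b + size h -> 0 < sz b h u.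
Proof.
move=> hu; rewrite /sz (@big_cat_nat _ _ _ u) //=; last lia.
rewrite [X in _ + X]big_ltn; last lia.
by rewrite anc_self //; lia.
Qed.

Lemma sz_le b h u : wf b h -> sz b h u <= size h.
Proof.
move=> wh; rewrite /sz (@big_cat_nat _ _ _ b) //=; last lia.
rewrite big_nat_cond big1 ?add0n => [|v]; last first.
  rewrite andbT => /andP[_ hv]; apply/eqP; rewrite eqb0.
  by apply/negP => /(anc_range wh)[]; lia.
apply: (@leq_trans (\sum_(b <= v < b + size h) 1)).
  by apply: leq_sum => v _; case: anc.
by rewrite sum_nat_const_nat; lia.
Qed.

Lemma sz_par b h v : wf b h -> b <= v < b + size h -> b <= par b h v ->
  sz b h v < sz b h (par b h v).
Proof.
move=> wh hv hp; have pv := par_lt wh hv.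
have hpv : anc b h (par b h v) v by rewrite anc_par // anc_self ?orbT //; lia.
have lt : par b h v < b + size h by lia.
rewrite /sz !big_mkord (bigD1 (Ordinal lt)) //= [X in _ < X](bigD1 (Ordinal lt)) //=.
have -> : anc b h v (par b h v) = false.
  by apply/negP => /(anc_range wh)[]; lia.
rewrite anc_self; last lia.
rewrite add0n add1n ltnS; apply: leq_sum => w _.
by case: (boolP (anc b h v w)) => // /(anc_trans wh hpv) ->.
Qed.

Lemma wf_cat b h h0 : wf b (h ++ h0) = wf (b + size h0) h && wf b h0.
Proof.
elim: h => [|i h IH] //=; rewrite IH size_cat andbA; congr (_ && _ && _).
by congr (_ < _); lia.
Qed.

(** Labels are absolute: what lies below a node born after [h0] depends on the later choices alone,
    and these form a history started with [b + size h0] nodes. This is what lets a window of choices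
    be studied as a fresh process. *)
Lemma anc_cat b h h0 u v : wf b h0 -> b + size h0 <= u ->
  anc b (h ++ h0) u v = anc (b + size h0) h u v.
Proof.
move=> wh hu; elim: h v => [|i h IH] v /=; first by rewrite anc_new_label.
by rewrite size_cat !IH; congr (if _ == _ then _ else _); lia.
Qed.

Lemma sz_cat b h h0 u : wf b h0 -> b + size h0 <= u ->
  sz b (h ++ h0) u = sz (b + size h0) h u.
Proof.
move=> wh hu; rewrite /sz size_cat.
have -> : b + (size h + size h0) = b + size h0 + size h by lia.
by apply: eq_bigr => v _; rewrite anc_cat.
Qed.

End Forest.

(** * Polya urns *)

Ltac nonzero :=
  repeat (apply/andP; split); first [done | apply: lt0r_neq0; lra].

Section Polya.
Variable R : realFieldType.
Implicit Types (k n s : nat).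

(* Probability that none of the next [k] nodes joins a subtree of size [s] in a tree
   with [n] nodes. *)
Definition miss k n s : R := \prod_(l < k) ((n - s + l)%:R / (n + l)%:R).

(** Effect on [miss] of the next node joining the subtree rather than avoiding it; it is the weight
    of one ancestor in a martingale increment. *)
Definition gap k n s : R := miss k n.+1 s - miss k n.+1 s.+1.

Lemma missS k n s : miss k.+1 n s = miss k n s * ((n - s + k)%:R / (n + k)%:R).
Proof. by rewrite /miss big_ord_recr. Qed.

Lemma miss_ge0 k n s : 0 <= miss k n s.
Proof. by apply: prodr_ge0 => l _; rewrite divr_ge0. Qed.

Lemma miss_le1 k n s : miss k n s <= 1.
Proof.
apply: prodr_ile1 => l _; rewrite divr_ge0 //=.
have [->|nl] := eqVneq (n + l)%N 0%N; first by rewrite invr0 mulr0.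
by rewrite ler_pdivrMr ?mul1r ?ler_nat ?ltr0n; lia.
Qed.

Lemma miss_le k n s t : (s <= t)%N -> miss k n t <= miss k n s.
Proof.
move=> st; apply: ler_prod => l _; rewrite divr_ge0 //=.
by rewrite ler_wpM2r ?invr_ge0 // ler_nat; lia.
Qed.

Lemma miss_birth k n : (0 < n)%N -> miss k n.+1 1 = n%:R / (n + k)%:R.
Proof.
move=> n0; elim: k => [|k IH].
  by rewrite /miss big_ord0 addn0 divff // pnatr_eq0; lia.
rewrite missS IH subSS subn0 mulrA divfK ?pnatr_eq0; last lia.
by congr (_ / _%:R); lia.
Qed.

Lemma gapS k n s : (s <= n)%N ->
  gap k.+1 n s = k.+1%:R / (n.+1 + k)%:R * miss k n.+1 s.
Proof.
move=> sn; rewrite /gap; elim: k => [|k IH].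
  rewrite !missS /miss !big_ord0 !mul1r mulr1 -mulrBl -[RHS]mul1r; congr (_ / _).
  by rewrite -[RHS]/(1%:R) -natrB; [congr _%:R|]; lia.
rewrite !(missS k.+1).
have -> : miss k.+1 n.+1 s.+1
  = miss k.+1 n.+1 s - k.+1%:R / (n.+1 + k)%:R * miss k n.+1 s.
  by rewrite -IH; ring.
rewrite (missS k).
have nk0 : (n.+1 + k)%:R != 0 :> R by rewrite pnatr_eq0; lia.
have nk1 : (n.+1 + k.+1)%:R != 0 :> R by rewrite pnatr_eq0; lia.
have -> : (n.+1 - s + k.+1)%:R = (n.+1 - s.+1 + k.+1)%:R + 1 :> R.
  by rewrite natr1; congr _%:R; lia.
have -> : (n.+1 - s + k)%:R = (n.+1 - s.+1 + k.+1)%:R :> R by congr _%:R; lia.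
rewrite -(natr1 k.+1).
have n0 := ler0n R n; have k0 := ler0n R k.
by field; nonzero.
Qed.

Lemma gap_ge0 k n s : 0 <= gap k n s.
Proof. by rewrite subr_ge0 miss_le. Qed.

Lemma gap_le k n s : (0 < k)%N -> (s <= n)%N -> gap k n s <= k%:R / (n + k)%:R.
Proof.
case: k => // k _ sn.
by rewrite gapS // addSnnS ler_piMr ?miss_le1 ?divr_ge0.
Qed.

Lemma gap_leaf k n : (0 < k)%N -> (0 < n)%N ->
  gap k n 1 = k%:R / (n + k)%:R * (n%:R / (n + k.-1)%:R).
Proof. by case: k => // k _ n0; rewrite gapS // miss_birth // addSnnS. Qed.

(** Exchangeability of the Polya urn: the left side is the probability that draws [1] to [k] all
    miss, the right side that draws [2] to [k + 1] do. So [miss] is harmonic for the urn, which is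
    the source of the martingale. *)
Lemma miss_step k n s : (0 < n)%N -> (s <= n)%N ->
  miss k n s = s%:R / n%:R * miss k n.+1 s.+1 + (1 - s%:R / n%:R) * miss k n.+1 s.
Proof.
move=> n0 sn; have nn0 : n%:R != 0 :> R by rewrite pnatr_eq0; lia.
elim: k => [|k IH].
  by rewrite /miss !big_ord0 !mulr1 addrC subrK.
case: k IH => [_|k IH].
  rewrite !missS /miss !big_ord0 !mul1r !addn0 subSn // -!natr1 natrB //.
  have n1 := ler0n R n.
  by field; nonzero.
have H : miss k.+1 n.+1 s.+1 = miss k.+1 n.+1 s - gap k.+1 n s by rewrite /gap; ring.
move: IH; rewrite !(missS k.+1) H gapS // !(missS k).
have nk0 : (n.+1 + k)%:R != 0 :> R by rewrite pnatr_eq0; lia.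
have nk1 : (n.+1 + k.+1)%:R != 0 :> R by rewrite pnatr_eq0; lia.
move=> IH; rewrite {}IH.
have -> : (n.+1 - s + k.+1 = n - s + k + 2)%N by lia.
have -> : (n.+1 - s.+1 + k.+1 = n - s + k + 1)%N by lia.
have -> : (n.+1 - s + k = n - s + k + 1)%N by lia.
rewrite !natrD natrB //.
move: nk0 nk1; rewrite !addSn !addnS -!natr1 !natrD => nk0 nk1.
have n1 := ler0n R n; have k0 := ler0n R k.
by field; nonzero.
Qed.

Lemma sum_gap k n i m : (i <= m)%N ->
  \sum_(i <= s < m) gap k n s = miss k n.+1 i - miss k n.+1 m.
Proof.
move=> im; rewrite -opprB -(telescope_sumr (miss k n.+1) im) -sumrN.
by apply: eq_bigr => s _; rewrite opprB.
Qed.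

(** Probability that the next three nodes all join the subtree. With three factors its mean decays
    like [u^-3], which stays summable against the weight [u] in [E1_corr_sqr]. *)
Definition rise3 n s : R := (s * s.+1 * s.+2)%:R / (n * n.+1 * n.+2)%:R.

Lemma miss_anti n s k l : (k <= l)%N -> miss l n s <= miss k n s.
Proof.
move=> /subnK <-; elim: (l - k)%N => [|m IH] //; apply: le_trans IH.
rewrite addSn missS ler_piMr ?miss_ge0 //.
have [->|nl] := eqVneq (n + (m + k))%N 0%N; first by rewrite invr0 mulr0.
by rewrite ler_pdivrMr ?mul1r ?ler_nat ?ltr0n; lia.
Qed.

(** When all new nodes miss the complement, they all join the subtree, in particular the first
    three. *)
Lemma miss_compl k n s : (2 < k)%N -> (0 < n)%N -> (s <= n)%N ->
  miss k n (n - s) <= rise3 n s.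
Proof.
move=> k2 n0 sn; apply: (le_trans (miss_anti _ _ k2)).
rewrite !missS /miss big_ord0 mul1r subKn // !addn0 !addn1 !addn2 /rise3.
by rewrite !natrM !mulf_div.
Qed.

Lemma rise3_step n s : (0 < n)%N ->
  rise3 n s = s%:R / n%:R * rise3 n.+1 s.+1 + (1 - s%:R / n%:R) * rise3 n.+1 s.
Proof.
move=> n0; rewrite /rise3 !natrM -!natr1.
have h0 : n%:R != 0 :> R by rewrite pnatr_eq0; lia.
have n1 := ler0n R n.
by field; nonzero.
Qed.

End Polya.

(** * Expectations over attachment histories *)

Section Expectation.
Variable R : realFieldType.

(** [P] plays the part of a support: inequalities under [E] need only be checked on [P], so
    histories can be taken well formed there. *)
Definition expectation (T : Type) (P : T -> Prop) (E : (T -> R) -> R) : Prop :=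
  [/\ forall a f g, E (fun x => a * f x + g x) = a * E f + E g,
      forall f g, (forall x, P x -> f x <= g x) -> E f <= E g
    & E (fun=> 1) = 1].

Section Basic.
Variables (T : Type) (P : T -> Prop) (E : (T -> R) -> R).
Hypothesis hE : expectation P E.

Lemma exp_le f g : (forall x, P x -> f x <= g x) -> E f <= E g.
Proof. by case: hE => _ h _; exact: h. Qed.

Lemma exp_eq f g : (forall x, P x -> f x = g x) -> E f = E g.
Proof. by move=> fg; apply/eqP; rewrite eq_le !exp_le // => x /fg->. Qed.

Lemma exp0 : E (fun=> 0) = 0.
Proof.
have [lin _ e1] := hE; have := lin (-1) (fun=> 1) (fun=> 1).
rewrite e1 (_ : (fun=> _) = fun=> 0) => [->|]; first by ring.
by apply: funext => x; ring.
Qed.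

Lemma expD f g : E (fun x => f x + g x) = E f + E g.
Proof.
have [lin _ _] := hE; rewrite -[E f]mul1r -lin.
by apply: exp_eq => x _; rewrite mul1r.
Qed.

Lemma expZ a f : E (fun x => a * f x) = a * E f.
Proof.
have [lin _ _] := hE; rewrite -[RHS]addr0 -exp0 -lin.
by apply: exp_eq => x _; rewrite addr0.
Qed.

Lemma expB f g : E (fun x => f x - g x) = E f - E g.
Proof.
rewrite -[- E g]mulN1r -expZ -expD; apply: exp_eq => x _; ring.
Qed.

Lemma exp_cst a : E (fun=> a) = a.
Proof.
have [_ _ e1] := hE; rewrite -[RHS]mulr1 -e1 -expZ.
by apply: exp_eq => x _; rewrite mulr1.
Qed.

Lemma exp_ge0 f : (forall x, P x -> 0 <= f x) -> 0 <= E f.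
Proof. by rewrite -[0 in X in _ -> X]exp0; apply: exp_le. Qed.

Lemma exp_sum (I : Type) (r : seq I) (Q : pred I) (F : I -> T -> R) :
  E (fun x => \sum_(i <- r | Q i) F i x) = \sum_(i <- r | Q i) E (F i).
Proof.
elim: r => [|i r IH].
  by rewrite big_nil -[RHS]exp0; apply: exp_eq => x _; rewrite big_nil.
rewrite big_cons -IH; case: ifP => Qi; last first.
  by apply: exp_eq => x _; rewrite big_cons Qi.
by rewrite -expD; apply: exp_eq => x _; rewrite big_cons Qi.
Qed.

Lemma exp_sqr f : E f ^+ 2 <= E (fun x => f x ^+ 2).
Proof.
have : 0 <= E (fun x => (f x - E f) ^+ 2) by apply: exp_ge0 => x _; exact: sqr_ge0.
rewrite (_ : E _ = E (fun x => f x ^+ 2) - E f ^+ 2) ?subr_ge0 //.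
rewrite (@exp_eq _ (fun x => f x ^+ 2 - (2 * E f) * f x + E f ^+ 2)); last first.
  by move=> x _; ring.
by rewrite expD expB expZ exp_cst; ring.
Qed.

Lemma exp_var f : E (fun x => (f x - E f) ^+ 2) = E (fun x => f x ^+ 2) - E f ^+ 2.
Proof.
rewrite (@exp_eq _ (fun x => f x ^+ 2 - (2 * E f) * f x + E f ^+ 2)); last first.
  by move=> x _; ring.
by rewrite expD expB expZ exp_cst; ring.
Qed.

End Basic.

Lemma exp_comp (S T U : Type) (P : S -> Prop) (Q : S -> T -> Prop) (C : U -> Prop)
    (phi : S -> T -> U) E (K : S -> (T -> R) -> R) :
    expectation P E -> (forall x, P x -> expectation (Q x) (K x)) ->
    (forall x y, P x -> Q x y -> C (phi x y)) ->
  expectation C (fun F => E (fun x => K x (fun y => F (phi x y)))).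
Proof.
move=> hE hK hC; split.
- move=> a f g; rewrite -(expZ hE) -(expD hE); apply: (exp_eq hE) => x Px.
  by rewrite -(expZ (hK x Px)) -(expD (hK x Px)).
- move=> f g fg; apply: (exp_le hE) => x Px; apply: (exp_le (hK x Px)) => y Qy.
  exact/fg/hC.
- rewrite -[RHS](exp_cst hE); apply: (exp_eq hE) => x Px.
  exact: (exp_cst (hK x Px)).
Qed.

Definition avg (m : nat) (F : nat -> R) : R := m%:R^-1 * \sum_(0 <= i < m) F i.

Lemma avg_expectation m : (0 < m)%N -> expectation (fun i => (i < m)%N) (avg m).
Proof.
move=> m0; have mn0 : m%:R != 0 :> R by rewrite pnatr_eq0; lia.
split.
- by move=> a f g; rewrite /avg big_split /= -mulr_sumr mulrDr mulrCA.
- move=> f g fg; rewrite ler_wpM2l ?invr_ge0 //.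
  by apply: ler_sum_nat => i /andP[_]; exact: fg.
- by rewrite /avg sumr_const_nat subn0 mulVf.
Qed.

Definition avg2 (alpha : R) (m : nat) (F : nat * nat -> R) : R :=
  alpha * avg m (fun i => F (i, i))
  + (1 - alpha) * avg m (fun i => avg m (fun j => F (i, j))).

Lemma avg2_expectation alpha m : 0 <= alpha <= 1 -> (0 < m)%N ->
  expectation (fun p => (p.1 < m)%N && (p.2 < m)%N) (avg2 alpha m).
Proof.
move=> /andP[a0 a1] m0; have hm := avg_expectation m0; split.
- move=> a f g; rewrite /avg2 (expD hm) (expZ hm).
  have -> : avg m (fun i => avg m (fun j => a * f (i, j) + g (i, j)))
    = a * avg m (fun i => avg m (fun j => f (i, j))) + avg m (fun i => avg m (fun j => g (i, j))).
    rewrite -(expZ hm) -(expD hm); apply: (exp_eq hm) => i _.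
    by rewrite (expD hm) (expZ hm).
  by ring.
- move=> f g fg; rewrite /avg2 lerD // ler_wpM2l ?subr_ge0 //.
    by apply: (exp_le hm) => i im; apply: fg; rewrite /= im.
  apply: (exp_le hm) => i im; apply: (exp_le hm) => j jm.
  by apply: fg; rewrite /= im.
- by rewrite /avg2 !(exp_cst hm); ring.
Qed.

Lemma avg2_fst alpha m F : (0 < m)%N -> avg2 alpha m (fun p => F p.1) = avg m F.
Proof.
move=> m0; have hm := avg_expectation m0; rewrite /avg2 /=.
have -> : avg m (fun i => avg m (fun=> F i)) = avg m F.
  by apply: (exp_eq hm) => i _; rewrite (exp_cst hm).
by change (alpha * avg m F + (1 - alpha) * avg m F = avg m F); ring.
Qed.

Lemma avg2_snd alpha m F : (0 < m)%N -> avg2 alpha m (fun p => F p.2) = avg m F.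
Proof.
move=> m0; rewrite /avg2 /= (exp_cst (avg_expectation m0)).
by change (alpha * avg m F + (1 - alpha) * avg m F = avg m F); ring.
Qed.

Lemma avg2_prod alpha m F G : (0 < m)%N ->
  avg2 alpha m (fun p => F p.1 * G p.2)
  = alpha * avg m (fun i => F i * G i) + (1 - alpha) * (avg m F * avg m G).
Proof.
move=> m0; have hm := avg_expectation m0; rewrite /avg2 /=; congr (_ + _ * _).
rewrite mulrC -(expZ hm); apply: (exp_eq hm) => i _.
by rewrite (expZ hm) mulrC.
Qed.

(** The newest choice is averaged innermost, with the older ones fixed, so conditioning on the past
    is a computation with [avg] at a fixed [h]. *)
Fixpoint E1 (b d : nat) (F : seq nat -> R) : R :=
  if d is d'.+1 then E1 b d' (fun h => avg (b + d') (fun i => F (i :: h)))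
  else F [::].

Fixpoint E2 (alpha : R) (b d : nat) (F : seq (nat * nat) -> R) : R :=
  if d is d'.+1 then E2 alpha b d' (fun h => avg2 alpha (b + d') (fun p => F (p :: h)))
  else F [::].

Definition history b d h := wf b h /\ size h = d.

Definition history2 b d (h : seq (nat * nat)) :=
  [/\ wf b (unzip1 h), wf b (unzip2 h) & size h = d].

Lemma E1_expectation b d : (0 < b)%N -> expectation (history b d) (E1 b d).
Proof.
move=> b0; elim: d => [|d IH] /=.
  by split=> // f g; apply.
apply: (exp_comp (Q := fun _ i => (i < b + d)%N) (phi := fun h i => i :: h)
                 (K := fun=> avg (b + d)) IH).
  by move=> h _; apply: avg_expectation; lia.
by move=> h i [wh sh] hi; split; rewrite /= ?sh // hi.
Qed.

Lemma E2_expectation alpha b d : 0 <= alpha <= 1 -> (0 < b)%N ->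
  expectation (history2 b d) (E2 alpha b d).
Proof.
move=> a01 b0; elim: d => [|d IH] /=.
  by split=> // f g; apply.
apply: (exp_comp (Q := fun _ p => (p.1 < b + d)%N && (p.2 < b + d)%N)
                 (phi := fun h i => i :: h) (K := fun=> avg2 alpha (b + d)) IH).
  by move=> h _; apply: avg2_expectation => //; lia.
move=> h [i j] [w1 w2 sh] /= /andP[hi hj].
by split; rewrite /= ?sh // size_map sh ?hi ?hj.
Qed.

Lemma E2_fst alpha b d F : (0 < b)%N ->
  E2 alpha b d (fun h => F (unzip1 h)) = E1 b d F.
Proof.
move=> b0; elim: d F => [|d IH] F //=; rewrite -IH; congr (E2 _ _ _ _).
apply: funext => h; rewrite (avg2_fst alpha (fun i => F (i :: unzip1 h))) //; lia.
Qed.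

Lemma E2_snd alpha b d F : (0 < b)%N ->
  E2 alpha b d (fun h => F (unzip2 h)) = E1 b d F.
Proof.
move=> b0; elim: d F => [|d IH] F //=; rewrite -IH; congr (E2 _ _ _ _).
apply: funext => h; rewrite (avg2_snd alpha (fun i => F (i :: unzip2 h))) //; lia.
Qed.

Lemma E2_cat alpha b d1 d2 F :
  E2 alpha b (d2 + d1) F
  = E2 alpha b d1 (fun h0 => E2 alpha (b + d1) d2 (fun h => F (h ++ h0))).
Proof.
elim: d2 F => [|d2 IH] F //=; rewrite IH; congr (E2 _ _ _ _).
apply: funext => h0; congr (E2 _ _ _ _); apply: funext => h.
by rewrite -addnA (addnC d1).
Qed.

(* Given the aligned choices, the two trees are independent with the same law. *)
Lemma E2_psd alpha b d F : 0 <= alpha <= 1 -> (0 < b)%N ->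
  E1 b d F ^+ 2 <= E2 alpha b d (fun h => F (unzip1 h) * F (unzip2 h)).
Proof.
move=> a01 b0; have /andP[a0 a1] := a01.
elim: d F => [|d IH] F; first by rewrite expr2.
have m0 : (0 < b + d)%N by lia.
have hm := avg_expectation m0.
have h1 := E1_expectation d b0.
have h2 := E2_expectation d a01 b0.
have step h : avg2 alpha (b + d) (fun p => F (unzip1 (p :: h)) * F (unzip2 (p :: h)))
  = alpha * avg (b + d) (fun i => F (i :: unzip1 h) * F (i :: unzip2 h))
    + (1 - alpha) * (avg (b + d) (fun i => F (i :: unzip1 h))
                     * avg (b + d) (fun i => F (i :: unzip2 h))).
  exact: (avg2_prod alpha (fun i => F (i :: unzip1 h)) (fun i => F (i :: unzip2 h))).
rewrite /= (funext step) (expD h2) (expZ h2 alpha) (expZ h2 (1 - alpha)).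
rewrite [leLHS](_ : _ = alpha * E1 b d.+1 F ^+ 2 + (1 - alpha) * E1 b d.+1 F ^+ 2); last by rewrite /=; ring.
(* The independent part is the induction hypothesis for the average of [F] over its newest
   choice. *)
apply: lerD; rewrite ler_wpM2l ?subr_ge0 //; last exact: IH.
rewrite [E2 _ _ _ _](_ : _ = avg (b + d) (fun i => E2 alpha b d
  (fun h => F (i :: unzip1 h) * F (i :: unzip2 h)))); last first.
  by rewrite /avg (expZ h2) (exp_sum h2).
have -> : E1 b d.+1 F = avg (b + d) (fun i => E1 b d (fun h => F (i :: h))).
  by rewrite /= /avg (expZ h1) (exp_sum h1).
(* The aligned part: Jensen over the common newest choice, then induction with that choice fixed. *)
apply: (le_trans (exp_sqr hm _)); apply: (exp_le hm) => i _.
exact: (IH (fun h => F (i :: h))).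
Qed.

End Expectation.

(** * The martingale of a scale *)

Section Martingale.
Variable R : realFieldType.
Implicit Types (k b d u i : nat) (h : seq nat).

(** The centring [k / (u + k)] is the value of [1 - miss] at the birth of [u], when its subtree has
    size 1 among [u + 1] nodes; each summand therefore starts at 0. *)
Definition mart k b h : R := \sum_(b <= u < b + size h)
  (1 - miss R k (b + size h) (sz b h u) - k%:R / (u + k)%:R).

(** Attaching to [i] enlarges exactly the subtrees of the ancestors of [i]; this is the increment of
    [mart] before centring. *)
Definition jump k b h i : R := \sum_(b <= u < b + size h)
  (anc b h u i)%:R * gap R k (b + size h) (sz b h u).

(** Ordering the pairs lets [anc_chain] turn two ancestors of one node into a nested pair. *)
Lemma sqr_sum_le (m n : nat) (a : nat -> R) : (forall u, 0 <= a u) ->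
  (\sum_(m <= u < n) a u) ^+ 2
  <= 2 * \sum_(m <= u < n) \sum_(m <= w < n) (u <= w)%N%:R * (a u * a w).
Proof.
move=> a0; rewrite expr2 big_distrlr /= mulr_natl mulr2n.
rewrite [X in _ <= _ + X]exchange_big /= -big_split /=; apply: ler_sum => u _.
rewrite -big_split /=; apply: ler_sum => w _.
rewrite [X in _ <= _ + _ * X]mulrC -mulrDl ler_peMl ?mulr_ge0 //.
by case: (leqP u w) => uw; rewrite ?lerDl // ltnW // add0r.
Qed.

Lemma avg_anc b h u : avg (b + size h) (fun i => (anc b h u i)%:R)
  = (sz b h u)%:R / (b + size h)%:R :> R.
Proof. by rewrite /avg /sz natr_sum mulrC. Qed.

Lemma avg_sz b h u (F : nat -> R) : (0 < b)%N ->
  avg (b + size h) (fun i => F (sz b h u + anc b h u i)%N)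
  = (sz b h u)%:R / (b + size h)%:R * F (sz b h u).+1
    + (1 - (sz b h u)%:R / (b + size h)%:R) * F (sz b h u).
Proof.
move=> b0; have m0 : (0 < b + size h)%N by lia.
have hm := avg_expectation R m0; set s := sz b h u.
rewrite (exp_eq hm (g := fun i => (F s.+1 - F s) * (anc b h u i)%:R + F s)).
  rewrite (expD hm) (expZ hm) (exp_cst hm) avg_anc -/s.
  by move: (_ / _) => x; ring.
by move=> i _; case: anc; rewrite /= ?addn1 ?addn0; ring.
Qed.

Lemma avg_jump k b h : (0 < b)%N -> avg (b + size h) (jump k b h)
  = \sum_(b <= u < b + size h)
      (sz b h u)%:R / (b + size h)%:R * gap R k (b + size h) (sz b h u).
Proof.
move=> b0; have m0 : (0 < b + size h)%N by lia.
have hm := avg_expectation R m0; rewrite /jump (exp_sum hm).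
apply: eq_bigr => u _; rewrite -avg_anc mulrC -(expZ hm).
by apply: (exp_eq hm) => i _; rewrite mulrC.
Qed.

(** The summand of the new node is 0 by [miss_birth], and [miss_step] splits each older one into its
    conditional mean and a centred change. *)
Lemma mart_cons k b h i : (0 < b)%N -> wf b (i :: h) ->
  mart k b (i :: h) = mart k b h + (jump k b h i - avg (b + size h) (jump k b h)).
Proof.
move=> b0 wh; have /andP[_ wh'] := wh; have m0 : (0 < b + size h)%N by lia.
rewrite /mart /= addnS big_nat_recr /=; last lia.
rewrite sz_cons_new // miss_birth // avg_jump //.
rewrite [X in _ + X](_ : _ = 0) ?addr0; last first.
  by rewrite -addrA -opprD -mulrDl -natrD divff ?subrr // pnatr_eq0; lia.
rewrite /jump -sumrB -big_split /=; apply: eq_big_nat => u /andP[_ hu].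
rewrite sz_cons_old // [in RHS](miss_step R k m0); last by have := sz_le u wh'; lia.
move: (_%:R / (b + size h)%:R) => x.
by rewrite /gap; case: (anc b h u i); rewrite /= ?addn1 ?addn0; ring.
Qed.

Lemma jump_ge0 k b h i : 0 <= jump k b h i.
Proof. by apply: sumr_ge0 => u _; rewrite mulr_ge0 ?gap_ge0. Qed.

Lemma jump_old k b h i : wf b h -> (i < b)%N -> jump k b h i = 0.
Proof.
move=> wh ib; apply: big1 => u _; case: (boolP (anc b h u i)); rewrite ?mul0r //.
by move=> /(anc_range wh)[]; lia.
Qed.

(* The sizes strictly increase along the chain of ancestors of [i], so that the
   gaps telescope. *)
Lemma jump_le k b h i : wf b h -> (b <= i < b + size h)%N ->
  jump k b h i <= miss R k (b + size h).+1 (sz b h i).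
Proof.
move=> wh; elim/ltn_ind: i => i IH hi.
have hp := par_lt wh hi; set p := par b h i.
have -> : jump k b h i = gap R k (b + size h) (sz b h i) + jump k b h p.
  rewrite /jump (big_cat_nat (n := i)) /=; try lia.
  rewrite [X in _ + X = _]big_ltn; last lia.
  rewrite anc_self // mul1r addrCA; congr (_ + _).
  rewrite [RHS](big_cat_nat (n := i)) /=; try lia.
  rewrite [X in _ = _ + X]big_ltn; last lia.
  have -> : anc b h i p = false by apply/negP => /(anc_range wh)[]; rewrite /p; lia.
  rewrite mul0r add0r; congr (_ + _); apply: eq_big_nat => u hu.
    by rewrite anc_par // ltn_eqF //; lia.
  rewrite (_ : anc b h u i = false); last by apply/negP => /(anc_range wh)[]; lia.
  by rewrite (_ : anc b h u p = false) //; apply/negP => /(anc_range wh)[]; rewrite /p; lia.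
rewrite /gap -lerBrDl opprB addrC subrK.
have [pb|bp] := ltnP p b; first by rewrite jump_old ?miss_ge0.
apply: (le_trans (IH p hp _)); first by rewrite /p; lia.
exact/miss_le/sz_par.
Qed.

Lemma jump_le1 k b h i : wf b h -> (i < b + size h)%N -> jump k b h i <= 1.
Proof.
move=> wh hi; have [ib|bi] := ltnP i b; first by rewrite jump_old.
by apply: (le_trans (jump_le k wh _)); rewrite ?miss_le1 // bi.
Qed.

(** Number of pairs [w], [v] with [w] on the path from [u] down to [v]: the total depth, counted in
    nodes, of the subtree of [u]. *)
Definition pathlen b h u : nat :=
  (\sum_(b <= w < b + size h) anc b h u w * sz b h w)%N.

(** Expand the square over nested ancestors [u], [w] of [i] and bound the gap of the lower one by
    [k / (n + k)]. Averaging over [i] then turns the pairs below [u] into its path length. *)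
Lemma avg_jump2 k b h : (0 < k)%N -> (0 < b)%N -> wf b h ->
  avg (b + size h) (fun i => jump k b h i ^+ 2)
  <= 2 * (k%:R / (b + size h + k)%:R) / (b + size h)%:R
     * \sum_(b <= u < b + size h)
         gap R k (b + size h) (sz b h u) * (pathlen b h u)%:R.
Proof.
move=> k0 b0 wh; have m0 : (0 < b + size h)%N by lia.
have hm := avg_expectation R m0; set x := _ / (_ + k)%:R; set j := (b + size h)%N.
pose g u := gap R k j (sz b h u).
have g0 u : 0 <= g u by exact: gap_ge0.
have x0 : 0 <= x by rewrite divr_ge0.
have gx u : g u <= x by apply: gap_le => //; have := sz_le u wh; rewrite /j; lia.
clearbody x.
apply: (le_trans (y := avg j (fun i => 2 * x * \sum_(b <= u < j) \sum_(b <= w < j)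
   g u * ((anc b h u w)%:R * (anc b h w i)%:R)))).
  apply: (exp_le hm) => i hi.
  apply: (le_trans (sqr_sum_le _ _ _)) => [u|]; first by rewrite mulr_ge0 ?gap_ge0.
  rewrite -mulrA ler_wpM2l // mulr_sumr; apply: ler_sum => u _.
  rewrite mulr_sumr; apply: ler_sum => w _.
  have [uw|] := leqP u w; last first.
    by move=> _; rewrite mul0r !mulr_ge0.
  rewrite mul1r; case: (boolP (anc b h u i)) => hu; last first.
    by rewrite !mul0r !mulr_ge0 ?x0 ?g0 ?ler0n.
  case: (boolP (anc b h w i)) => hw; last by rewrite mul0r !mulr0.
  by rewrite (anc_chain wh hu hw uw) !mul1r !mulr1 mulrC; apply: ler_wpM2r; [exact: g0|exact: gx].
rewrite (expZ hm) -!mulrA ler_wpM2l // ler_wpM2l //.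
rewrite (exp_sum hm) mulr_sumr; apply: ler_sum => u _; rewrite (exp_sum hm).
rewrite le_eqVlt; apply/orP; left; apply/eqP; rewrite /pathlen natr_sum !mulr_sumr; apply: eq_bigr => w _.
have -> : (fun i => g u * ((anc b h u w)%:R * (anc b h w i)%:R))
  = (fun i => (g u * (anc b h u w)%:R) * (anc b h w i)%:R).
  by apply: funext => i; rewrite mulrA.
by rewrite (expZ hm) avg_anc natrM -/(g u) -/j; move: (j%:R^-1) => y; ring.
Qed.

Lemma pathlen_new b h i : wf b (i :: h) -> pathlen b (i :: h) (b + size h) = 1%N.
Proof.
move=> wh; have /andP[_ wh'] := wh.
rewrite /pathlen /= addnS big_nat_recr /=; last lia.
rewrite sz_cons_new // !eqxx big_nat_cond big1 // => w /andP[hw _].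
by rewrite ltn_eqF ?anc_new_label //; lia.
Qed.

Lemma pathlen_old b h i u : wf b (i :: h) -> (u < b + size h)%N ->
  pathlen b (i :: h) u
  = (pathlen b h u + (\sum_(b <= w < b + size h) anc b h u w * anc b h w i)
     + anc b h u i)%N.
Proof.
move=> wh hu; have /andP[_ wh'] := wh.
rewrite /pathlen /= addnS big_nat_recr /=; last lia.
rewrite sz_cons_new // eqxx ltn_eqF //= muln1 -big_split /=; congr (_ + _)%N.
apply: eq_big_nat => w /andP[_ hw].
by rewrite ltn_eqF // sz_cons_old // mulnDr.
Qed.

Lemma avg_path b h u : (0 < b)%N ->
  avg (b + size h) (fun i => (\sum_(b <= w < b + size h) anc b h u w * anc b h w i)%:R)
  = (pathlen b h u)%:R / (b + size h)%:R :> R.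
Proof.
move=> b0; have m0 : (0 < b + size h)%N by lia.
have hm := avg_expectation R m0.
have -> : (fun i => (\sum_(b <= w < b + size h) anc b h u w * anc b h w i)%:R)
  = (fun i => \sum_(b <= w < b + size h) (anc b h u w)%:R * (anc b h w i)%:R) :> (nat -> R).
  by apply: funext => i; rewrite natr_sum; apply: eq_bigr => w _; rewrite natrM.
rewrite (exp_sum hm) /pathlen natr_sum mulr_suml; apply: eq_bigr => w _.
by rewrite (expZ hm) avg_anc natrM mulrA.
Qed.

(** The factor [s + 1] in place of [s] comes from the growth of the path length itself, by
    [pathlen / n] on average. *)
Lemma avg_pathlen b h u (F : nat -> R) : (0 < b)%N -> wf b h -> (u < b + size h)%N ->
  avg (b + size h) (fun i => F (sz b (i :: h) u) * (pathlen b (i :: h) u)%:R)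
  = (pathlen b h u)%:R
    * ((1 - (sz b h u)%:R / (b + size h)%:R) * F (sz b h u)
       + (sz b h u).+1%:R / (b + size h)%:R * F (sz b h u).+1)
    + (sz b h u)%:R / (b + size h)%:R * F (sz b h u).+1.
Proof.
move=> b0 wh hu; have m0 : (0 < b + size h)%N by lia.
have hm := avg_expectation R m0; set s := sz b h u; set P := pathlen b h u.
pose dep i : nat := (\sum_(b <= w < b + size h) anc b h u w * anc b h w i)%N.
rewrite (exp_eq hm (g := fun i => F s * P%:R
  + ((F s.+1 - F s) * P%:R * (anc b h u i)%:R
  + F s.+1 * ((dep i)%:R + (anc b h u i)%:R)))); last first.
  move=> i hi; have whi : wf b (i :: h) by rewrite /= hi.
  rewrite sz_cons_old // pathlen_old // -/s -/P -/(dep i).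
  case: (boolP (anc b h u i)) => hui; first by rewrite !natrD addn1 /=; ring.
  have -> : dep i = 0%N.
    rewrite /dep big1 // => w _; apply/eqP; rewrite muln_eq0 !eqb0 -negb_and.
    by apply: contra hui => /andP[h1 h2]; apply: anc_trans h2.
  by rewrite !addn0 /=; ring.
rewrite (expD hm) (exp_cst hm) (expD hm) !(expZ hm) (expD hm) avg_anc.
rewrite avg_path // -/s -/P -(natr1 s).
by move: ((b + size h)%:R^-1) => y; ring.
Qed.

End Martingale.

(** * Second moment of the jumps *)

Section SizeSums.
Variable R : realFieldType.
Implicit Types (k b d u i : nat) (h : seq nat) (F : nat -> R).

Definition sizesum b F h : R := \sum_(b <= u < b + size h) F (sz b h u).

Lemma avg_sizesum b h F : (0 < b)%N -> wf b h ->
  avg (b + size h) (fun i => sizesum b F (i :: h))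
  = sizesum b (fun s => (1 - s%:R / (b + size h)%:R) * F s
                        + s%:R / (b + size h)%:R * F s.+1) h + F 1%N.
Proof.
move=> b0 wh; have m0 : (0 < b + size h)%N by lia.
have hm := avg_expectation R m0.
rewrite (exp_eq hm (g := fun i => \sum_(b <= u < b + size h)
   F (sz b h u + anc b h u i)%N + F 1%N)); last first.
  move=> i hi; have whi : wf b (i :: h) by rewrite /= hi.
  rewrite /sizesum /= addnS big_nat_recr /=; last lia.
  rewrite sz_cons_new //; congr (_ + _); apply: eq_big_nat => u /andP[_ hu].
  by rewrite sz_cons_old.
rewrite (expD hm) (exp_cst hm) (exp_sum hm); congr (_ + _).
by apply: eq_bigr => u _; rewrite avg_sz // addrC.
Qed.

Definition pathsum b F h : R :=
  \sum_(b <= u < b + size h) F (sz b h u) * (pathlen b h u)%:R.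

Lemma avg_pathsum b h F : (0 < b)%N -> wf b h ->
  avg (b + size h) (fun i => pathsum b F (i :: h))
  = pathsum b (fun s => (1 - s%:R / (b + size h)%:R) * F s
                        + s.+1%:R / (b + size h)%:R * F s.+1) h
    + sizesum b (fun s => s%:R / (b + size h)%:R * F s.+1) h + F 1%N.
Proof.
move=> b0 wh; have m0 : (0 < b + size h)%N by lia.
have hm := avg_expectation R m0.
rewrite (exp_eq hm (g := fun i => \sum_(b <= u < b + size h)
   F (sz b (i :: h) u) * (pathlen b (i :: h) u)%:R + F 1%N)); last first.
  move=> i hi; have whi : wf b (i :: h) by rewrite /= hi.
  rewrite /pathsum /= addnS big_nat_recr /=; last lia.
  by rewrite sz_cons_new // pathlen_new // mulr1.
rewrite (expD hm) (exp_cst hm) (exp_sum hm) /pathsum /sizesum -big_split /=.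
congr (_ + _); apply: eq_big_nat => u /andP[_ hu].
by rewrite avg_pathlen // mulrC.
Qed.

(** The weight [n / (s (s + 1))] is the mean number of subtrees of size [s] in a uniform attachment
    tree with [n > s] nodes. It satisfies the mean recursion exactly, so the only loss is at
    [d = 0], where nothing is tracked. *)
Lemma E1_sizesum_le b d F : (0 < b)%N -> (forall s, (s < b + d)%N -> 0 <= F s) ->
  E1 b d (sizesum b F)
  <= \sum_(1 <= s < b + d) F s * ((b + d)%:R / (s * s.+1)%:R).
Proof.
move=> b0; elim: d F => [|d IH] F F0.
  rewrite /= /sizesum addn0 [leLHS]big_geq // big_nat_cond.
  by apply: sumr_ge0 => s /andP[/andP[_ hs] _]; rewrite mulr_ge0 ?divr_ge0 ?F0 ?addn0.
have h1 := E1_expectation R d b0.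
set j := (b + d)%N; have j0 : (0 < j)%N by rewrite /j; lia.
pose F' s := (1 - s%:R / j%:R) * F s + s%:R / j%:R * F s.+1.
have -> : E1 b d.+1 (sizesum b F) = E1 b d (sizesum b F') + F 1%N.
  rewrite /= -[F 1%N in RHS](exp_cst h1) -(expD h1).
  by apply: (exp_eq h1) => h [wh sh]; rewrite -sh avg_sizesum // sh.
have frac s : (s < j)%N -> 0 <= 1 - s%:R / j%:R :> R.
  by move=> sj; rewrite subr_ge0 ler_pdivrMr ?ltr0n // mul1r ler_nat ltnW.
apply: (le_trans (lerD (IH F' _) (lexx _))).
  move=> s sj; have := F0 s; have := F0 s.+1; rewrite addnS => h2 h3.
  by rewrite addr_ge0 // mulr_ge0 ?frac ?divr_ge0 ?h2 ?h3 //; lia.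
rewrite -/j addnS -/j le_eqVlt; apply/orP; left; apply/eqP.
have jn0 : j%:R != 0 :> R by rewrite pnatr_eq0; lia.
rewrite (@eq_big_nat _ _ _ 1%N j _ (fun s => (j%:R - s%:R) * F s / (s * s.+1)%:R
   + F s.+1 / s.+1%:R)); last first.
  move=> s /andP[s1 sj]; rewrite /F' natrM -natr1.
  have s0 : 0 < s%:R :> R by rewrite ltr0n.
  by field; nonzero.
rewrite big_split /= -addrA.
rewrite [X in _ + (X + _)](_ : _ = \sum_(2 <= s < j.+1) F s / s%:R); last first.
  by rewrite [RHS]big_add1.
rewrite [in RHS]big_nat_recr //= [X in _ + X](_ : _ = \sum_(1 <= s < j.+1) F s / s%:R); last first.
  by rewrite [RHS]big_ltn // addrC divr1.
rewrite [X in _ + X]big_nat_recr //= addrA -big_split /=; congr (_ + _).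
  apply: eq_big_nat => s /andP[s1 _]; rewrite natrM -!natr1.
  have s0 : 0 < s%:R :> R by rewrite ltr0n.
  by field; nonzero.
rewrite natrM -natr1; have s0 : 0 < j%:R :> R by rewrite ltr0n.
by field; nonzero.
Qed.

End SizeSums.

(** * Path lengths and square-root bounds *)

Section Roots.
Variable R : rcfType.
Implicit Types (k b d u i : nat) (h : seq nat) (F : nat -> R).

Lemma sqrt_step (s : nat) : 1 <= (s%:R + 1) * (Num.sqrt s.+1%:R - Num.sqrt s%:R) * 2 :> R.
Proof.
set a : R := Num.sqrt s%:R; set c : R := Num.sqrt s.+1%:R.
have a0 : 0 <= a by exact: sqrtr_ge0.
have c0 : 0 <= c by exact: sqrtr_ge0.
have a2 : a ^+ 2 = s%:R by rewrite sqr_sqrtr.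
have c2 : c ^+ 2 = s%:R + 1 by rewrite sqr_sqrtr // natr1.
have c1 : 1 <= c by rewrite -[leLHS]sqrtr1 ler_wsqrtr // ler1n.
have ac : a <= c by rewrite ler_wsqrtr // ler_nat.
have : (c - a) * (c + a) = 1 by rewrite -subr_sqr c2 a2; ring.
nra.
Qed.

(** The mean path length of a subtree of size [s] is of order [s log s]; [2 s^(3/2)] dominates it
    and involves only square roots. *)
Definition pathbound (s : nat) : R := 2 * s%:R * Num.sqrt s%:R.

Lemma E1_pathsum_le b d F : (0 < b)%N -> (forall s, (s < b + d)%N -> 0 <= F s) ->
  E1 b d (pathsum b F) <= E1 b d (sizesum b (fun s => F s * pathbound s)).
Proof.
move=> b0; elim: d F => [|d IH] F F0.
  by rewrite /= /pathsum /sizesum addn0 !big_geq.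
have h1 := E1_expectation R d b0.
set j := (b + d)%N; have j0 : (0 < j)%N by rewrite /j; lia.
pose F' s := (1 - s%:R / j%:R) * F s + s.+1%:R / j%:R * F s.+1.
have -> : E1 b d.+1 (pathsum b F) = E1 b d (pathsum b F')
  + E1 b d (fun h => sizesum b (fun s => s%:R / j%:R * F s.+1) h + F 1%N).
  rewrite -(expD h1); apply: (exp_eq h1) => h [wh sh].
  by rewrite -sh avg_pathsum // sh addrA.
have frac s : (s < j)%N -> 0 <= 1 - s%:R / j%:R :> R.
  by move=> sj; rewrite subr_ge0 ler_pdivrMr ?ltr0n // mul1r ler_nat ltnW.
apply: (le_trans (lerD (IH F' _) (lexx _))).
  move=> s sj; have := F0 s; have := F0 s.+1; rewrite addnS => h2 h3.
  by rewrite addr_ge0 // mulr_ge0 ?frac ?divr_ge0 ?h2 ?h3 //; lia.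
rewrite -(expD h1) /=; apply: (exp_le h1) => h [wh sh].
rewrite -sh avg_sizesum // sh -/j addrA; apply: lerD; last first.
  rewrite /pathbound mulr1 sqrtr1 mulr1 ler_peMr ?ler1n //; apply: F0; lia.
rewrite /sizesum sh -big_split /=; apply: ler_sum_nat => u hu.
have s1 : (0 < sz b h u)%N by apply: sz_gt0; rewrite sh.
have sj : (sz b h u < j)%N by have := sz_le u wh; rewrite sh /j; lia.
move: (sz b h u) s1 sj => s s1 sj; rewrite /F' /= mulrDl -addrA [in leRHS]mulrA lerD2l.
have Fs : 0 <= F s.+1 by apply: F0; rewrite addnS ltnS -/j.
have -> : s.+1%:R / j%:R * F s.+1 * pathbound s + s%:R / j%:R * F s.+1
  = (s.+1%:R * pathbound s + s%:R) * (F s.+1 / j%:R).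
  by move: (j%:R^-1) => y; ring.
have -> : s%:R / j%:R * (F s.+1 * pathbound s.+1)
  = (s%:R * pathbound s.+1) * (F s.+1 / j%:R).
  by move: (j%:R^-1) => y; ring.
rewrite ler_wpM2r ?divr_ge0 // /pathbound.
(* After division by [s (s + 1)] the claim reads [2 sqrt s + 1 / (s + 1) <= 2 sqrt (s + 1)], which
   is [sqrt_step]. *)
have := sqrt_step s; rewrite -natr1.
move: (Num.sqrt _) (Num.sqrt _) => c a H; have s0 : 0 <= s%:R :> R by [].
nra.
Qed.

Lemma sum_gap_sqrt k j : (0 < k)%N -> (0 < j)%N ->
  \sum_(1 <= s < j) gap R k j s / Num.sqrt s%:R <= 3 * Num.sqrt (k%:R / (j + k)%:R).
Proof.
move=> k0 j0; set x := _ / _; have x0 : 0 < x by rewrite divr_gt0 ?ltr0n; lia.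
set r := Num.sqrt x; have r0 : 0 < r by rewrite sqrtr_gt0.
have r2 : r * r = x by rewrite -expr2 sqr_sqrtr // ltW.
(* Two regimes, split at [s = 1 / x]. Above, [1 / sqrt s <= r] and the gaps sum to at most 1. Below,
   the gap is at most [x] and [1 / sqrt s] is at most an increment of [2 sqrt s]. Capping this
   potential at [2 / r] makes the second part telescope to at most [2 r]. *)
pose T (s : nat) : R := Num.min (2 * Num.sqrt s%:R) (2 / r).
have Tle : T j <= 2 / r by rewrite /T ge_min lexx orbT.
apply: (le_trans (y := \sum_(1 <= s < j) (r * gap R k j s + x * (T s - T s.-1)))).
  apply: ler_sum_nat => s /andP[s1 sj].
  have g0 := gap_ge0 R k j s; have gx : gap R k j s <= x by apply: gap_le => //; lia.
  case: s s1 sj g0 gx => // s _ sj g0 gx /=.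
  set a : R := Num.sqrt s.+1%:R; have a0 : 0 < a by rewrite sqrtr_gt0 ltr0n.
  have ba : Num.sqrt s%:R <= a by rewrite ler_wsqrtr // ler_nat.
  have Tm : T s <= T s.+1.
    by rewrite /T le_min !ge_min ler_pM2l // ba lexx orbT.
  have [ra|ar] := lerP (a^-1) r.
    apply: (@le_trans _ _ (r * gap R k j s.+1)); first by rewrite mulrC ler_wpM2r.
    by rewrite lerDl mulr_ge0 ?subr_ge0 ?(ltW x0).
  have ra1 : a < r^-1 by rewrite -[a]invrK ltf_pV2 ?posrE ?invr_gt0.
  have T1 : T s.+1 = 2 * a by apply/min_idPl; rewrite ler_pM2l // ltW.
  have T0 : T s = 2 * Num.sqrt s%:R.
    by apply/min_idPl; rewrite ler_pM2l // ltW // (le_lt_trans ba).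
  rewrite T1 T0; apply: (@le_trans _ _ (x * a^-1)); first by rewrite ler_wpM2r // invr_ge0 ltW.
  rewrite -[leLHS]add0r lerD ?mulr_ge0 ?(ltW r0) // ler_wpM2l ?(ltW x0) //.
  rewrite -div1r ler_pdivrMr //; move: ba; set c := Num.sqrt _ => ca.
  have c0 : 0 <= c by exact: sqrtr_ge0.
  have a2 : a ^+ 2 = s%:R + 1 by rewrite sqr_sqrtr // natr1.
  have c2 : c ^+ 2 = s%:R by rewrite sqr_sqrtr.
  nra.
rewrite big_split /= -!mulr_sumr sum_gap //.
have -> : \sum_(1 <= s < j) (T s - T s.-1) = T j.-1 - T 0%N.
  have -> : j = j.-1.+1 by lia.
  by rewrite big_add1 /= telescope_sumr.
have Tl : T j.-1 <= 2 / r by rewrite /T ge_min lexx orbT.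
have T0 : 0 <= T 0%N by rewrite /T le_min !mulr_ge0 ?sqrtr_ge0 ?invr_ge0 ?(ltW r0).
have m1 : miss R k j.+1 1 - miss R k j.+1 j <= 1.
  by rewrite -[leRHS]subr0 lerB ?miss_le1 ?miss_ge0.
have H1 : r * (miss R k j.+1 1 - miss R k j.+1 j) <= r by rewrite ler_piMr // ltW.
have H2 : x * (T j.-1 - T 0%N) <= x * (2 / r) by rewrite ler_wpM2l ?(ltW x0) // lerBlDr; lra.
have H3 : x * (2 / r) = 2 * r by rewrite -r2; field; nonzero.
lra.
Qed.

(* Ancestors of small size are few by the path-length estimate, and those of
   large size contribute little because the gaps sum to at most one. *)
Lemma E1_jump2_le k b d : (0 < k)%N -> (0 < b)%N ->
  E1 b d (fun h => avg (b + d) (fun i => jump R k b h i ^+ 2))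
  <= 12 * (k%:R / (b + d + k)%:R) * Num.sqrt (k%:R / (b + d + k)%:R).
Proof.
move=> k0 b0; have h1 := E1_expectation R d b0.
set j := (b + d)%N; have j0 : (0 < j)%N by rewrite /j; lia.
set x := k%:R / (j + k)%:R; have x0 : 0 <= x by rewrite divr_ge0.
apply: (le_trans (y := E1 b d (fun h => 2 * x / j%:R * pathsum b (gap R k j) h))).
  apply: (exp_le h1) => h [wh sh]; have := avg_jump2 R k0 b0 wh.
  by rewrite /pathsum sh.
have c0 : 0 <= 2 * x / j%:R by rewrite !mulr_ge0 ?invr_ge0.
rewrite (expZ h1); apply: (le_trans (ler_wpM2l c0 (E1_pathsum_le b0 _))).
  by move=> s _; exact: gap_ge0.
apply: (le_trans (ler_wpM2l c0 (E1_sizesum_le b0 _))).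
  by move=> s _; rewrite !mulr_ge0 ?gap_ge0 ?sqrtr_ge0.
rewrite -/j; apply: (le_trans (y := 4 * x * \sum_(1 <= s < j) gap R k j s / Num.sqrt s%:R)); last first.
  have -> : 12 * x * Num.sqrt x = 4 * x * (3 * Num.sqrt x) by ring.
  by apply: ler_wpM2l; [exact: mulr_ge0|exact: sum_gap_sqrt].
rewrite !mulr_sumr; apply: ler_sum_nat => s /andP[s1 sj].
have g0 := gap_ge0 R k j s; move: (gap R k j s) g0 => g g0.
rewrite /pathbound natrM -(natr1 s).
have s0 : 0 < s%:R :> R by rewrite ltr0n.
set a := Num.sqrt s%:R; have a0 : 0 < a by rewrite sqrtr_gt0.
have a2 : s%:R = a * a :> R by rewrite -expr2 sqr_sqrtr.
have j1 : 0 < j%:R :> R by rewrite ltr0n.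
rewrite /= a2; have -> : 2 * x / j%:R * (g * (2 * (a * a) * a) * (j%:R / (a * a * (a * a + 1))))
  = 4 * x * (g * (a / (a * a + 1))) by field; nonzero; nra.
apply: ler_wpM2l; first exact: mulr_ge0.
apply: ler_wpM2l => //; rewrite ler_pdivrMr; last by nra.
by rewrite mulrDr mulKf ?gt_eqF // mulr1 lerDl invr_ge0 ltW.
Qed.

End Roots.

(** * Moments of the martingale *)

(** Histories are listed newest first, so the [r] oldest choices form a suffix. *)
Definition past (T : Type) (r : nat) (h : seq T) : seq T := drop (size h - r) h.

Lemma past_cons (T : Type) r (x : T) h : (r <= size h)%N -> past r (x :: h) = past r h.
Proof. by move=> hr; rewrite /past /= subSn. Qed.

Lemma past_size (T : Type) (h : seq T) : past (size h) h = h.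
Proof. by rewrite /past subnn drop0. Qed.

Section Moments.
Variable R : realFieldType.
Implicit Types (k b d u i : nat) (h : seq nat) (F : nat -> R).

Definition incr k b h i : R := jump R k b h i - avg (b + size h) (jump R k b h).

Lemma avg_incr k b h : (0 < b)%N -> avg (b + size h) (incr k b h) = 0.
Proof.
move=> b0; have hm := avg_expectation R (m := b + size h) ltac:(lia).
by rewrite /incr (expB hm) (exp_cst hm) subrr.
Qed.

Lemma incr_sqr_le1 k b h i : (0 < b)%N -> wf b h -> (i < b + size h)%N ->
  incr k b h i ^+ 2 <= 1.
Proof.
move=> b0 wh hi; have hm := avg_expectation R (m := b + size h) ltac:(lia).
have j0 := jump_ge0 R k b h i; have j1 := jump_le1 R k wh hi.
have a0 : 0 <= avg (b + size h) (jump R k b h).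
  by apply: (exp_ge0 hm) => l _; exact: jump_ge0.
have a1 : avg (b + size h) (jump R k b h) <= 1.
  by rewrite -[leRHS](exp_cst hm); apply: (exp_le hm) => l; exact: jump_le1.
rewrite /incr; nra.
Qed.

Lemma avg_incr2 k b h : (0 < b)%N ->
  avg (b + size h) (fun i => incr k b h i ^+ 2)
  <= avg (b + size h) (fun i => jump R k b h i ^+ 2).
Proof.
move=> b0; have hm := avg_expectation R (m := b + size h) ltac:(lia).
by rewrite (exp_var hm) lerBlDr lerDl sqr_ge0.
Qed.

Lemma avg_mart_sqr k b h (c : R) : (0 < b)%N -> wf b h ->
  avg (b + size h) (fun i => (mart R k b (i :: h) - c) ^+ 2)
  = (mart R k b h - c) ^+ 2 + avg (b + size h) (fun i => incr k b h i ^+ 2).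
Proof.
move=> b0 wh; have hm := avg_expectation R (m := b + size h) ltac:(lia).
set x := mart R k b h - c.
rewrite (exp_eq hm (g := fun i => x ^+ 2 + (2 * x * incr k b h i + incr k b h i ^+ 2))).
  by rewrite (expD hm) (exp_cst hm) (expD hm) (expZ hm) avg_incr //; ring.
by move=> i hi; rewrite mart_cons //= ?hi // -/(incr k b h i) /x; ring.
Qed.

Lemma E1_mart_sqr k b d : (0 < b)%N ->
  E1 b d (fun h => mart R k b h ^+ 2) <= d%:R.
Proof.
move=> b0; elim: d => [|d IH].
  by rewrite /= /mart big_geq ?expr0n // addn0.
have h1 := E1_expectation R d b0.
rewrite -natr1; apply: (le_trans _ (lerD IH (lexx 1))).
rewrite -[X in _ <= _ + X](exp_cst h1) -(expD h1) /=; apply: (exp_le h1) => h [wh sh].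
have hm := avg_expectation R (m := b + size h) ltac:(lia).
rewrite -sh (exp_eq hm (g := fun i => (mart R k b (i :: h) - 0) ^+ 2)).
  rewrite avg_mart_sqr // subr0 lerD2l -[leRHS](exp_cst hm).
  by apply: (exp_le hm) => i; exact: incr_sqr_le1.
by move=> i _; rewrite subr0.
Qed.

(** An increment [y] is centred with [y^2 <= 1], so a step from [x] adds at most [8 x^2 + 3] to the
    fourth moment. As the second moment is at most [d], the recursion closes:
    [7 d^2 + 8 d + 3 <= 7 (d + 1)^2]. *)
Lemma E1_mart_pow4 k b d : (0 < b)%N ->
  E1 b d (fun h => mart R k b h ^+ 4) <= 7 * d%:R ^+ 2.
Proof.
move=> b0; elim: d => [|d IH].
  by rewrite /= /mart big_geq ?expr0n //= ?mulr0 // addn0.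
have h1 := E1_expectation R d b0.
have d0 : 0 <= d%:R :> R by [].
apply: (le_trans (y := E1 b d (fun h => mart R k b h ^+ 4 + (8 * mart R k b h ^+ 2 + 3)))); last first.
  rewrite (expD h1) (expD h1) (expZ h1) (exp_cst h1) -natr1.
  have := E1_mart_sqr k d b0.
  move: (E1 b d _) (E1 b d _) IH => x y IH H; nra.
rewrite /=; apply: (exp_le h1) => h [wh sh]; rewrite -sh.
have hm := avg_expectation R (m := b + size h) ltac:(lia).
set x := mart R k b h.
apply: (le_trans (y := avg (b + size h) (fun i => x ^+ 4 + 4 * x ^+ 3 * incr k b h i + (8 * x ^+ 2 + 3)))).
  apply: (exp_le hm) => i hi; have := incr_sqr_le1 k b0 wh hi.
  rewrite mart_cons //= ?hi // -/(incr k b h i) -/x; move: (incr k b h i) => y y2.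
  have -> : (x + y) ^+ 4 = x ^+ 4 + 4 * x ^+ 3 * y
     + (6 * x ^+ 2 * y ^+ 2 + 4 * (x * y) * y ^+ 2 + y ^+ 2 * y ^+ 2) by ring.
  rewrite lerD2l.
  have y0 : 0 <= y ^+ 2 by exact: sqr_ge0.
  have x0 : 0 <= x ^+ 2 by exact: sqr_ge0.
  have H1 : x ^+ 2 * y ^+ 2 <= x ^+ 2 by rewrite ler_piMr.
  have H2 : 2 * (x * y) <= x ^+ 2 + y ^+ 2 by have := sqr_ge0 (x - y); nra.
  have H3 : y ^+ 2 * y ^+ 2 <= 1 by nra.
  have H4 : 2 * (x * y) * y ^+ 2 <= (x ^+ 2 + y ^+ 2) * y ^+ 2 by rewrite ler_wpM2r.
  nra.
by rewrite !(expD hm) (expZ hm) !(exp_cst hm) avg_incr // mulr0 addr0.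
Qed.

(** The subtree of [u] is a Polya urn started at size 1 among [u + 1] nodes, and a harmonic function
    keeps its starting value in mean. *)
Lemma harmonic_E1 b d u (G : nat -> nat -> R) : (0 < b)%N ->
  (forall n s, (0 < n)%N -> (s <= n)%N ->
    G n s = s%:R / n%:R * G n.+1 s.+1 + (1 - s%:R / n%:R) * G n.+1 s) ->
  (b <= u < b + d)%N -> E1 b d (fun h => G (b + d)%N (sz b h u)) = G u.+1 1%N.
Proof.
move=> b0 hG; elim: d => [|d IH] hu; first lia.
have h1 := E1_expectation R d b0.
have [ud|du] := eqVneq u (b + d)%N.
  rewrite -[RHS](exp_cst h1) /=; apply: (exp_eq h1) => h [wh sh]; rewrite -sh.
  have hm := avg_expectation R (m := b + size h) ltac:(lia).
  rewrite -[RHS](exp_cst hm); apply: (exp_eq hm) => i hi.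
  by rewrite ud -sh sz_cons_new ?addnS //= hi.
rewrite -IH; last lia.
rewrite /=; apply: (exp_eq h1) => h [wh sh]; rewrite -sh.
have hm := avg_expectation R (m := b + size h) ltac:(lia).
rewrite hG; try (have := sz_le u wh; lia).
rewrite -(avg_sz h u (G (b + size h).+1)) //.
apply: (exp_eq hm) => i hi; rewrite sz_cons_old ?addnS //=; last lia.
by rewrite hi.
Qed.

Lemma E1_sz b d u : (0 < b)%N -> (b <= u < b + d)%N ->
  E1 b d (fun h => (sz b h u)%:R / (b + d)%:R) = u.+1%:R^-1 :> R.
Proof.
move=> b0 hu; rewrite (harmonic_E1 (G := fun n s => s%:R / n%:R) b0 _ hu) ?div1r //.
move=> n s n0 sn; have n1 : 0 < n%:R :> R by rewrite ltr0n.
by rewrite -!natr1; field; nonzero.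
Qed.

Lemma E1_miss k b d u : (0 < b)%N -> (b <= u < b + d)%N ->
  E1 b d (fun h => miss R k (b + d) (sz b h u)) = u%:R / (u + k)%:R.
Proof.
move=> b0 hu; rewrite (harmonic_E1 (G := miss R k) b0 _ hu) ?miss_birth //; first by lia.
exact: miss_step.
Qed.

Lemma E1_rise3 b d u : (0 < b)%N -> (b <= u < b + d)%N ->
  E1 b d (fun h => rise3 R (b + d) (sz b h u)) = 6 / (u.+1 * u.+2 * u.+3)%:R.
Proof.
move=> b0 hu; rewrite (harmonic_E1 (G := rise3 R) b0 _ hu) //.
by move=> n s n0 _; exact: rise3_step.
Qed.

(** By [miss_step], passing from [n + 1] back to [n] nodes in the bound of [jump_le] costs at most
    [s / n]. Both resulting means are small when [i] is large but far below [k]. *)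
Lemma E1_jump_le k b d i : (0 < b)%N -> (b <= i < b + d)%N ->
  E1 b d (fun h => jump R k b h i) <= i%:R / (i + k)%:R + i.+1%:R^-1.
Proof.
move=> b0 hi; have h1 := E1_expectation R d b0.
rewrite -(E1_miss k b0 hi) -(E1_sz b0 hi) -(expD h1); apply: (exp_le h1) => h [wh sh].
apply: (le_trans (jump_le R k wh _)); rewrite ?sh //.
set s := sz b h i; have sd : (s <= b + d)%N by have := sz_le i wh; rewrite -/s; lia.
rewrite (miss_step R k _ sd); last lia.
have j0 : 0 < (b + d)%:R :> R by rewrite ltr0n; lia.
have x0 : 0 <= s%:R / (b + d)%:R :> R by rewrite divr_ge0.
have := miss_ge0 R k (b + d).+1 s.+1; have := miss_le1 R k (b + d).+1 s.
move: (s%:R / _) x0 (miss _ _ _ _) (miss _ _ _ _) => x x0 y z H1 H2.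
nra.
Qed.

(** Leaves follow the recursion [N' = (1 - 1 / n) N + 1]. The factor [n - 1] is kept on the left
    because it vanishes for a single node. *)
Lemma E1_leaves b d : (0 < b)%N ->
  2 * ((b + d)%:R - 1) * E1 b d (sizesum b (fun s => (s == 1%N)%:R))
  = (b + d)%:R * ((b + d)%:R - 1) - b%:R * (b%:R - 1) :> R.
Proof.
move=> b0; elim: d => [|d IH].
  by rewrite /= /sizesum addn0 big_geq ?addn0 // mulr0 subrr.
have h1 := E1_expectation R d b0.
set j := (b + d)%N; have j0 : 0 < j%:R :> R by rewrite ltr0n /j; lia.
have -> : E1 b d.+1 (sizesum b (fun s => (s == 1%N)%:R))
  = (1 - j%:R^-1) * E1 b d (sizesum b (fun s => (s == 1%N)%:R)) + 1 :> R.
  rewrite -(expZ h1) -[X in _ = _ + X](exp_cst h1) -(expD h1) /=.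
  apply: (exp_eq h1) => h [wh sh]; rewrite -sh avg_sizesum // sh -/j eqxx; congr (_ + _).
  rewrite /sizesum mulr_sumr; apply: eq_big_nat => u hu.
  have s1 := sz_gt0 hu; case: (sz b h u) s1 => // s _.
  by rewrite !eqSS; case: s => [|s] /=; rewrite ?mulr0 ?mulr1 ?addr0 ?div1r.
rewrite addnS -(natr1 (b + d)) -/j.
set N := E1 b d _ in IH *.
have -> : 2 * (j%:R + 1 - 1) * ((1 - j%:R^-1) * N + 1) = 2 * (j%:R - 1) * N + 2 * j%:R.
  by field; nonzero.
by rewrite IH -/j; ring.
Qed.

Lemma E1_avg_jump_ge k b d : (0 < b)%N -> (400 * (b + 100) <= k)%N ->
  (k <= b + d <= 2 * k)%N ->
  24%:R^-1 <= E1 b d (fun h => avg (b + d) (jump R k b h)).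
Proof.
move=> b0 bk /andP[kj jk]; have h1 := E1_expectation R d b0.
set j := (b + d)%N in kj jk *; have j0 : 0 < j%:R :> R by rewrite ltr0n; lia.
have k0 : 0 < k%:R :> R by rewrite ltr0n; lia.
apply: (le_trans (y := gap R k j 1 / j%:R * E1 b d (sizesum b (fun s => (s == 1%N)%:R)))).
  have HN := E1_leaves d b0; rewrite -/j in HN.
  (* One factor of the leaf gap is at least [1 / 3] because [n <= 2 k], the other at least [1 / 2]
     because [k <= n]. *)
  have g6 : 6^-1 <= gap R k j 1.
    rewrite gap_leaf; try lia.
    have -> : (6^-1 : R) = 3^-1 * 2^-1 by field.
    have jk0 : 0 < (j + k)%:R :> R by rewrite ltr0n; lia.
    have jk1 : 0 < (j + k.-1)%:R :> R by rewrite ltr0n; lia.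
    rewrite ler_pM ?invr_ge0 //.
      rewrite ler_pdivlMr // mulrC ler_pdivrMr // -natrM ler_nat; lia.
    rewrite ler_pdivlMr // mulrC ler_pdivrMr // -natrM ler_nat; lia.
  have bj : 2 * b%:R <= j%:R :> R by rewrite -natrM ler_nat; lia.
  have b1 : 1 <= b%:R :> R by rewrite ler1n.
  set N := E1 b d _ in HN *.
  have N4 : 4^-1 * j%:R <= N.
    (* As [2 b <= n], the initial nodes remove at most half of [n (n - 1)], which leaves at least
       [n / 4] leaves in mean. *)
    have Hb : b%:R * (b%:R - 1) <= 2^-1 * j%:R * (j%:R - 1) :> R.
      by apply: ler_pM; lra.
    have j1 : 0 < j%:R - 1 :> R by lra.
    rewrite -(ler_pM2l j1); lra.
  rewrite -mulrA; have -> : (24%:R^-1 : R) = 6^-1 * 4^-1 by field.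
  by rewrite ler_pM ?invr_ge0 // mulrC ler_pdivlMr.
rewrite -(expZ h1); apply: (exp_le h1) => h [wh sh].
rewrite /j -sh avg_jump // /sizesum mulr_sumr; apply: ler_sum => u _.
have [->|_] := eqVneq (sz b h u) 1%N; first by rewrite mulr1 mulrC div1r.
by rewrite mulr0 mulr_ge0 ?gap_ge0 ?divr_ge0.
Qed.

(** At least one choice in 400 has a mean increment of absolute value at least [1 / 50]. *)
Definition rate : R := (400 * 50 ^+ 2)^-1.

Lemma rate_gt0 : 0 < rate.
Proof. by rewrite invr_gt0; apply: mulr_gt0; [|apply: exprn_gt0]; rewrite ltr0n. Qed.

(* A choice [i] among the nodes of label at most [k / 100] has a large subtree, hence
   a small mean jump, while the leaves alone make the average jump at least 1/24. *)
Lemma incr_mean_var k b d : (0 < b)%N -> (400 * (b + 100) <= k)%N ->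
  (k <= b + d <= 2 * k)%N ->
  rate <= avg (b + d) (fun i => E1 b d (fun h => incr k b h i) ^+ 2).
Proof.
move=> b0 bk kj; have h1 := E1_expectation R d b0.
have mean := E1_avg_jump_ge b0 bk kj.
set j := (b + d)%N in kj mean *; have j0 : 0 < j%:R :> R by rewrite ltr0n; lia.
(* In this range both terms of [E1_jump_le] are at most [1 / 100], and
   [1 / 24 - 2 / 100 >= 1 / 50]. *)
have old i : (b + 100 <= i < k %/ 100)%N ->
    50^-1 ^+ 2 <= E1 b d (fun h => incr k b h i) ^+ 2.
  move=> hi; have hi' : (b <= i < b + d)%N by lia.
  have := E1_jump_le k b0 hi'.
  have -> : E1 b d (fun h => incr k b h i)
    = E1 b d (fun h => jump R k b h i) - E1 b d (fun h => avg j (jump R k b h)).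
    by rewrite -(expB h1); apply: (exp_eq h1) => h [_ sh]; rewrite /incr /j sh.
  have H1 : i%:R / (i + k)%:R <= 100^-1 :> R.
    rewrite ler_pdivrMr ?ltr0n; last lia.
    by rewrite mulrC ler_pdivlMr // -natrM ler_nat; lia.
  have H2 : i.+1%:R^-1 <= 100^-1 :> R by rewrite lef_pV2 ?posrE ?ltr0n // ler_nat; lia.
  move: (E1 b d _) (E1 b d _) mean => x y mean H3.
  have H5 := le_trans H3 (lerD H1 H2).
  have H4 : 50^-1 <= y - x by lra.
  have -> : (x - y) ^+ 2 = (y - x) ^+ 2 by ring.
  by rewrite ler_sqr ?nnegrE //; lra.
rewrite /avg mulrC ler_pdivlMr //.
apply: (le_trans (y := \sum_(b + 100 <= i < k %/ 100) 50^-1 ^+ 2)).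
  rewrite sumr_const_nat -[leRHS]mulr_natr /rate.
  have : j%:R <= 400 * (k %/ 100 - (b + 100))%:R :> R by rewrite -natrM ler_nat; lia.
  by move: (_ - _)%N => n H; lra.
apply: (le_trans (ler_sum_nat old)).
rewrite [leRHS](big_cat_nat (n := b + 100)) /=; try lia.
rewrite [X in _ <= _ + X](big_cat_nat (n := k %/ 100)) /=; try lia.
rewrite addrCA lerDl addr_ge0 //; apply: sumr_ge0 => i _; exact: sqr_ge0.
Qed.

End Moments.

(** * Tail variance and covariance between the trees *)

Section Tail.
Variable R : rcfType.

Definition isqrt (n : nat) : R := (Num.sqrt n%:R)^-1.

(** Comparison of [y^(-3/2)] with the decrease of [2 y^(-1/2)]: it puts the bound of [E1_jump2_le]
    in telescoping form. *)
Lemma isqrt_step k y : (0 < y)%N ->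
  12 * (k%:R / y.+1%:R) * Num.sqrt (k%:R / y.+1%:R)
  <= 24 * k%:R * Num.sqrt k%:R * (isqrt y - isqrt y.+1).
Proof.
move=> y0; rewrite /isqrt sqrtrM // sqrtrV //.
set K : R := Num.sqrt k%:R; set Y : R := Num.sqrt y.+1%:R; set Z : R := Num.sqrt y%:R.
have Z0 : 0 < Z by rewrite sqrtr_gt0 ltr0n.
have Y0 : 0 < Y by rewrite sqrtr_gt0 ltr0n.
have K0 : 0 <= K by exact: sqrtr_ge0.
have Y2 : y.+1%:R = Y ^+ 2 :> R by rewrite sqr_sqrtr.
have Z2 : Y ^+ 2 = Z ^+ 2 + 1 by rewrite !sqr_sqrtr // natr1.
have k0 : 0 <= k%:R :> R by [].
rewrite Y2; have -> : 12 * (k%:R / Y ^+ 2) * (K / Y) = 12 * (k%:R * K) * (Y ^+ 3)^-1.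
  by field; nonzero.
have -> : 24 * k%:R * K * (Z^-1 - Y^-1) = 12 * (k%:R * K) * (2 * (Y - Z) / (Z * Y)).
  by field; nonzero.
apply: ler_wpM2l; first by rewrite !mulr_ge0.
rewrite ler_pdivlMr ?mulr_gt0 // mulrC ler_pdivrMr ?exprn_gt0 //.
have ZY : Z <= Y by rewrite ler_wsqrtr // ler_nat.
have D1 : (Y - Z) * (Y + Z) = 1 by rewrite -subr_sqr Z2; ring.
have D2 : 1 <= 2 * (Y - Z) * Y by nra.
have -> : 2 * (Y - Z) * Y ^+ 3 = (2 * (Y - Z) * Y) * (Y * Y) by ring.
have YY : 0 < Y * Y by rewrite mulr_gt0.
apply: (@le_trans _ _ (1 * (Y * Y))); last by rewrite ler_wpM2r // ltW.
by rewrite mul1r ler_wpM2r // ltW.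
Qed.

(** Martingale increments are orthogonal, so the per-step bounds add up and telescope. With [r = 0]
    this gives a variance of order [k]; for [r] much larger than [k] it is small compared with
    [k]. *)
Lemma E1_mart_tail k b d r : (0 < k)%N -> (0 < b)%N -> (r <= d)%N ->
  E1 b d (fun h => (mart R k b h - mart R k b (past r h)) ^+ 2)
  <= 24 * k%:R * Num.sqrt k%:R * (isqrt (b + r + k.-1) - isqrt (b + d + k.-1)).
Proof.
move=> k0 b0; elim: d => [|d IH] rd.
  have -> : r = 0%N by lia.
  by rewrite /= /past subrr expr0n /= subrr mulr0.
have h1 := E1_expectation R d b0; have h1S := E1_expectation R d.+1 b0.
have [e|ne] := eqVneq r d.+1.
  rewrite e subrr mulr0 (exp_eq h1S (g := fun=> 0)) ?(exp0 h1S) // => h [_ sh].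
  by rewrite -sh past_size subrr expr0n.
have {}rd : (r <= d)%N by lia.
have step := isqrt_step k (y := b + d + k.-1) ltac:(lia).
have ek : (b + d + k.-1).+1 = (b + d + k)%N by lia.
rewrite ek in step; have jump2 := E1_jump2_le R d k0 b0.
apply: (le_trans (y := E1 b d (fun h => (mart R k b h - mart R k b (past r h)) ^+ 2
   + avg (b + d) (fun i => jump R k b h i ^+ 2)))); last first.
  rewrite (expD h1); apply: (le_trans (lerD (IH rd) (le_trans jump2 step))).
  rewrite -mulrDr; have -> : (b + d.+1 + k.-1 = b + d + k)%N by lia.
  by rewrite addrA subrK.
rewrite /=; apply: (exp_le h1) => h [wh sh]; rewrite -sh.
have hm := avg_expectation R (m := b + size h) ltac:(lia).
rewrite (exp_eq hm (g := fun i => (mart R k b (i :: h) - mart R k b (past r h)) ^+ 2)).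
  by rewrite avg_mart_sqr // lerD2l avg_incr2.
by move=> i _; rewrite past_cons ?sh.
Qed.

End Tail.

Section Covariance.
Variable R : realFieldType.
Implicit Types (k b d : nat).
Variables (alpha : R).
Hypothesis a01 : 0 <= alpha <= 1.

Definition mart2 k b (h : seq (nat * nat)) : R :=
  mart R k b (unzip1 h) * mart R k b (unzip2 h).

(** Only aligned choices contribute: the increments are centred, so the cross terms vanish, and
    under independent choices the product of the two increments averages to 0 as well. *)
Lemma E2_mart2_step k b d : (0 < b)%N ->
  E2 alpha b d.+1 (mart2 k b) = E2 alpha b d (mart2 k b)
  + alpha * avg (b + d) (fun i =>
      E2 alpha b d (fun h => incr R k b (unzip1 h) i * incr R k b (unzip2 h) i)).
Proof.
move=> b0; have h2 := E2_expectation d a01 b0.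
have -> : avg (b + d) (fun i =>
      E2 alpha b d (fun h => incr R k b (unzip1 h) i * incr R k b (unzip2 h) i))
   = E2 alpha b d (fun h => avg (b + d) (fun i =>
       incr R k b (unzip1 h) i * incr R k b (unzip2 h) i)).
  by rewrite /avg (expZ h2) (exp_sum h2).
rewrite -(expZ h2) -(expD h2) /=; apply: (exp_eq h2) => h [w1 w2 sh].
have s1 : size (unzip1 h) = d by rewrite size_map.
have s2 : size (unzip2 h) = d by rewrite size_map.
have m0 : (0 < b + d)%N by lia.
have hm := avg_expectation R m0.
have hm2 := avg2_expectation a01 m0.
rewrite (exp_eq hm2 (g := fun p => (mart R k b (unzip1 h) + incr R k b (unzip1 h) p.1)
   * (mart R k b (unzip2 h) + incr R k b (unzip2 h) p.2))); last first.
  move=> [i j] /= /andP[hi hj]; rewrite /mart2 /= !mart_cons //= ?s1 ?s2 ?hi ?hj //.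
rewrite (avg2_prod alpha (fun i => mart R k b (unzip1 h) + incr R k b (unzip1 h) i)
   (fun i => mart R k b (unzip2 h) + incr R k b (unzip2 h) i)) //.
have z1 : avg (b + d) (incr R k b (unzip1 h)) = 0 by have := avg_incr R k (unzip1 h) b0; rewrite s1.
have z2 : avg (b + d) (incr R k b (unzip2 h)) = 0 by have := avg_incr R k (unzip2 h) b0; rewrite s2.
rewrite /mart2; move: (mart _ _ _ _) (mart _ _ _ _) => y x.
move: (incr _ _ _ _) (incr _ _ _ _) z1 z2 => g f z1 z2.
have e1 : avg (b + d) (fun i => x + f i) = x by rewrite (expD hm) (exp_cst hm) z1 addr0.
have e2 : avg (b + d) (fun i => y + g i) = y by rewrite (expD hm) (exp_cst hm) z2 addr0.
have e3 : avg (b + d) (fun i => (x + f i) * (y + g i)) = x * y + avg (b + d) (fun i => f i * g i).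
  rewrite (exp_eq hm (g := fun i => x * y + (x * g i + (y * f i + f i * g i)))).
    by rewrite !(expD hm) !(expZ hm) (exp_cst hm) z1 z2; ring.
  by move=> i _; ring.
by rewrite e1 e2 e3; ring.
Qed.

Lemma E2_mart2_ge k b d : (0 < b)%N -> (400 * (b + 100) <= k)%N ->
  (2 * k <= b + d)%N -> alpha * (rate R * k%:R) <= E2 alpha b d (mart2 k b).
Proof.
move=> b0 bk; have /andP[a0 _] := a01.
have var_ge n : avg (b + n) (fun i => E1 b n (fun h => incr R k b h i) ^+ 2)
    <= avg (b + n) (fun i => E2 alpha b n (fun h =>
          incr R k b (unzip1 h) i * incr R k b (unzip2 h) i)).
  have hm := avg_expectation R (m := b + n) ltac:(lia).
  apply: (exp_le hm) => i _; exact: (E2_psd n (fun h => incr R k b h i) a01 b0).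
have var_ge0 n : 0 <= avg (b + n) (fun i => E2 alpha b n (fun h =>
          incr R k b (unzip1 h) i * incr R k b (unzip2 h) i)).
  apply: (le_trans _ (var_ge n)).
  have hm := avg_expectation R (m := b + n) ltac:(lia).
  by apply: (exp_ge0 hm) => i _; exact: sqr_ge0.
have mono n m : (n <= m)%N -> E2 alpha b n (mart2 k b) <= E2 alpha b m (mart2 k b).
  elim: m => [|m IH] nm; first by have -> : n = 0%N by lia.
  have [->//|ne] := eqVneq n m.+1.
  apply: (le_trans (IH _)); first lia.
  by rewrite E2_mart2_step // lerDl mulr_ge0.
(* The tree has [k + e] nodes here: the [k] steps from [k] to [2 k] nodes satisfy [incr_mean_var],
   and each adds at least [alpha * rate]. *)
have early e : (e <= k)%N -> alpha * (rate R * e%:R) <= E2 alpha b (k - b + e) (mart2 k b).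
  elim: e => [|e IH] ek.
    rewrite !mulr0; apply: (le_trans _ (mono 0%N _ _)) => //.
    by rewrite /= /mart2 /= /mart big_geq ?mul0r // addn0.
  rewrite addnS E2_mart2_step // -natr1 mulrDr mulrDr mulr1.
  apply: lerD; first by apply: IH; lia.
  apply: ler_wpM2l => //; apply: (le_trans _ (var_ge _)).
  by apply: incr_mean_var => //; lia.
move=> hd; apply: (le_trans (early k _)) => //; apply: mono; lia.
Qed.

Lemma E2_mart2_sqr_le k b d : (0 < b)%N ->
  E2 alpha b d (fun h => mart2 k b h ^+ 2) <= 7 * d%:R ^+ 2.
Proof.
move=> b0; have h2 := E2_expectation d a01 b0.
apply: (le_trans (y := E2 alpha b d (fun h =>
   2^-1 * mart R k b (unzip1 h) ^+ 4 + 2^-1 * mart R k b (unzip2 h) ^+ 4))).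
  apply: (exp_le h2) => h _; rewrite /mart2.
  move: (mart _ _ _ _) (mart _ _ _ _) => x y.
  have := sqr_ge0 (x ^+ 2 - y ^+ 2); nra.
rewrite (expD h2) !(expZ h2) (E2_fst alpha d (fun h => mart R k b h ^+ 4)) //.
rewrite (E2_snd alpha d (fun h => mart R k b h ^+ 4)) //.
have := E1_mart_pow4 R k d b0; lra.
Qed.

End Covariance.

Lemma E2_mart2_indep (R : realFieldType) k b d : (0 < b)%N ->
  E2 0 b d (mart2 R k b) = 0.
Proof.
move=> b0; elim: d => [|d IH].
  by rewrite /= /mart2 /= /mart big_geq ?mul0r // addn0.
by rewrite E2_mart2_step ?lexx ?ler01 // IH mul0r addr0.
Qed.

(** * The statistic as a sum over edges *)

Section Invariant.
Variable R : realFieldType.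

Definition uncut (m : nat) (G : graph m) (e : {set 'I_m}) : rel 'I_m :=
  fun x y => [set x; y] \in G :\ e.

Definition side (m : nat) (G : graph m) (e : {set 'I_m}) (x : 'I_m) : nat :=
  #|[pred y | connect (uncut G e) x y]|.

(** Symmetric in the two ends of an edge, hence blind to the root. In a tree, for [k > 0], the
    summand is the probability that the next [k] nodes hit both sides of [e], since they cannot miss
    both. *)
Definition edgesum (k m : nat) (G : graph m) : R :=
  \sum_(e in G) (1 - \sum_(x in e) miss R k m (side G e x)).

Lemma uncut_relabel m (G : graph m) (e : {set 'I_m}) (s : {perm 'I_m}) x y :
  uncut (relabel s G) (s @: e) (s x) (s y) = uncut G e x y.
Proof.
have sI : injective (fun A : {set 'I_m} => s @: A) by apply: imset_inj; exact: perm_inj.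
rewrite /uncut /relabel -(imset_set1 s x) -(imset_set1 s y) -imsetU !in_setD1.
by rewrite (inj_eq sI) (mem_imset _ _ sI).
Qed.

Lemma connect_uncut_relabel m (G : graph m) (e : {set 'I_m}) (s : {perm 'I_m}) x y :
  connect (uncut (relabel s G) (s @: e)) (s x) (s y) = connect (uncut G e) x y.
Proof.
apply/connectP/connectP => -[p].
- move=> hp hy; exists (map (s^-1)%g p).
    elim: p x hp {hy} => [|z p IH] x //= /andP[hz hp].
    rewrite -(uncut_relabel _ _ s) permKV hz /=; apply: IH.
    by rewrite permKV.
  by rewrite -[x](permK s) last_map -hy permK.
- move=> hp ->; exists (map s p); last by rewrite last_map.
  elim: p x hp => [|z p IH] x //= /andP[hz hp].
  by rewrite uncut_relabel hz IH.
Qed.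

Lemma side_relabel m (G : graph m) (e : {set 'I_m}) (s : {perm 'I_m}) x :
  side (relabel s G) (s @: e) (s x) = side G e x.
Proof.
rewrite /side -[RHS](card_imset _ (@perm_inj _ s)); apply: eq_card => y.
rewrite -[y](permKV s) (mem_imset _ _ (@perm_inj _ s)) !inE.
exact: connect_uncut_relabel.
Qed.

Lemma edgesum_relabel k m (G : graph m) (s : {perm 'I_m}) :
  edgesum k (relabel s G) = edgesum k G.
Proof.
have sI : injective (fun A : {set 'I_m} => s @: A) by apply: imset_inj; exact: perm_inj.
rewrite /edgesum /relabel big_imset /=; last by move=> A B _ _; exact: sI.
apply: eq_bigr => e _; congr (_ - _).
rewrite big_imset /=; last by move=> x y _ _; exact: perm_inj.
by apply: eq_bigr => x _; rewrite -/(relabel s G) side_relabel.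
Qed.

(** The choice of representative is immaterial on an isomorphism class by [edgesum_relabel]; 0 is
    the default on the empty set. *)
Definition edgesum_class (k m : nat) (U : {set graph m}) : R :=
  if [pick G in U] is Some G then edgesum k G else 0.

Lemma edgesum_classE k m (G : graph m) :
  edgesum_class k (unlabeled G) = edgesum k G.
Proof.
rewrite /edgesum_class; case: pickP => [H|/(_ G)].
  rewrite inE /isomorphic => /existsP[s /eqP <-].
  exact: edgesum_relabel.
rewrite inE /isomorphic => /negbT/negP[]; apply/existsP; exists 1%g; apply/eqP.
apply/finset.setP => A; apply/imsetP/idP => [[B BG ->]|AG].
  by rewrite (eq_imset (g := id)) ?imset_id // => x; rewrite perm1.
by exists A => //; rewrite (eq_imset (g := id)) ?imset_id // => x; rewrite perm1.
Qed.

End Invariant.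

(** * The tree of an attachment history *)

Section Build.

(** For a well-formed history of length [n] every parent is below its child, so [inord] keeps its
    value. *)
Definition tree (n : nat) (h : seq nat) : graph n.+1 :=
  [set [set v; inord (par 1 h v)] | v : 'I_n.+1 & (0 < v)%N].

Lemma attach_tree n h (i : 'I_n.+1) : wf 1 h -> size h = n ->
  attach (tree n h) i = tree n.+1 (val i :: h).
Proof.
move=> wh sh; set w := widen_ord (leqnSn n.+1).
have wI : injective w by move=> x y /(congr1 val) /= /val_inj.
have par_old (v : 'I_n.+1) : (0 < v)%N ->
    [set w v; inord (par 1 (val i :: h) (w v))] = w @: [set v; inord (par 1 h v)].
  move=> v0; rewrite imsetU !imset_set1; congr (_ |: [set _]); apply: val_inj => /=.
  have vn := ltn_ord v; have pv : (par 1 h v < v)%N by apply: par_lt; rewrite ?sh; lia.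
  by rewrite sh ltn_eqF // !inordK //; lia.
apply/finset.setP => A; rewrite /attach /relabel finset.in_setU finset.in_set1.
apply/orP/imsetP => [[/eqP->|/imsetP[B /imsetP[v v0 ->] ->]]|[v v0 ->]].
- exists ord_max; first by rewrite inE.
  congr [set _; _]; apply: val_inj; rewrite /= sh eqxx inordK //.
  by have := ltn_ord i; lia.
- exists (w v); first by move: v0; rewrite !inE.
  by rewrite -/w par_old //; move: v0; rewrite inE.
- have [e|ne] := eqVneq v ord_max.
    left; rewrite e /= sh eqxx; apply/eqP; congr [set _; _].
    by apply: val_inj; rewrite /= inordK //; have := ltn_ord i; lia.
  have vn : (v < n.+1)%N.
    have := ltn_ord v; rewrite ltnS leq_eqVlt => /orP[/eqP e|//].
    by case/eqP: ne; apply: val_inj.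
  have e : v = w (Ordinal vn) by apply: val_inj.
  move: v0; rewrite inE => v0; right; apply/imsetP.
  exists [set Ordinal vn; inord (par 1 h v)]; last by rewrite {1 2}e par_old.
  by apply/imsetP; exists (Ordinal vn); rewrite ?inE.
Qed.

Variables (n : nat) (h : seq nat).
Hypotheses (wh : wf 1 h) (sh : size h = n).

Let p (v : 'I_n.+1) : 'I_n.+1 := inord (par 1 h v).

Let pE (v : 'I_n.+1) : (0 < v)%N -> p v = par 1 h v :> nat.
Proof.
move=> v0; have vn := ltn_ord v.
have pv : (par 1 h v < v)%N by apply: par_lt; rewrite ?sh; lia.
by rewrite /p inordK //; lia.
Qed.

Let p_lt (v : 'I_n.+1) : (0 < v)%N -> (p v < v)%N.
Proof.
move=> v0; have vn := ltn_ord v.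
by rewrite pE // par_lt // sh; lia.
Qed.

(** An edge determines its child as its endpoint of larger label. *)
Let edge_inj (v w : 'I_n.+1) : (0 < v)%N -> (0 < w)%N ->
  [set v; p v] = [set w; p w] -> v = w.
Proof.
move=> v0 w0 e; have pv := p_lt v0; have pw := p_lt w0.
have : v \in [set w; p w] by rewrite -e !inE eqxx.
have : w \in [set v; p v] by rewrite e !inE eqxx.
rewrite !inE => /orP[/eqP->//|/eqP ew] /orP[/eqP //|/eqP ev].
by move: pv pw; rewrite -ew -ev; lia.
Qed.

Let anc_p (u v : 'I_n.+1) : (0 < v)%N -> anc 1 h u v = (u == v) || anc 1 h u (p v).
Proof.
by move=> v0; rewrite pE // anc_par // sh v0 add1n ltn_ord.
Qed.

Section Edge.
Variable u : 'I_n.+1.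
Hypothesis u0 : (0 < u)%N.
Let r := uncut (tree n h) [set u; p u].

Let r_edge (v : 'I_n.+1) : (0 < v)%N -> v != u -> r v (p v).
Proof.
move=> v0 vu; rewrite /r /uncut in_setD1; apply/andP; split.
  by apply: contra vu => /eqP /(edge_inj v0 u0) ->.
by apply/imsetP; exists v; rewrite ?inE.
Qed.

Let r_sym : symmetric r.
Proof. by move=> x y; rewrite /r /uncut finset.setUC. Qed.

(** Descent from [u] is invariant along every edge other than the one above [u]. Conversely,
    climbing parents joins each descendant to [u] and every other node to the root, so these are the
    two components. *)
Let r_anc (x y : 'I_n.+1) : r x y -> anc 1 h u x = anc 1 h u y.
Proof.
rewrite /r /uncut in_setD1 => /andP[ne /imsetP[v]]; rewrite inE => v0 e.
have vu : u != v.
  by apply: contra ne => /eqP ->; rewrite e.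
have step : anc 1 h u v = anc 1 h u (p v) by rewrite anc_p // (negPf vu).
have : v \in [set x; y] by rewrite e !inE eqxx.
have : p v \in [set x; y] by rewrite e !inE eqxx orbT.
have pv : p v != v by rewrite -val_eqE /= ltn_eqF ?p_lt.
by rewrite !inE => /orP[/eqP ex|/eqP ey] /orP[/eqP ex'|/eqP ey'];
  move: pv step; rewrite ?ex ?ey ?ex' ?ey' ?eqxx // => _ ->.
Qed.

Let connect_anc x y : connect r x y -> anc 1 h u x = anc 1 h u y.
Proof.
move=> /connectP[q hq ->]; elim: q x hq => [|z q IH] x //= /andP[/r_anc -> hq].
exact: IH.
Qed.

Let anc_uu : anc 1 h u u.
Proof. by rewrite anc_self // u0 sh add1n ltn_ord. Qed.

Let below (y : 'I_n.+1) : anc 1 h u y -> connect r u y.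
Proof.
have [m] := ubnP (y : nat); elim: m y => // m IH y ym hy.
have [<-//|uy] := eqVneq u y.
have y0 : (0 < y)%N by have [] := anc_range wh hy; lia.
move: hy; rewrite anc_p // (negPf uy) /= => hy.
have py := p_lt y0; apply: connect_trans (IH _ _ hy) _; first lia.
by apply: connect1; rewrite r_sym r_edge // eq_sym.
Qed.

Let above (y : 'I_n.+1) : ~~ anc 1 h u y -> connect r y ord0.
Proof.
have [m] := ubnP (y : nat); elim: m y => // m IH y ym hy.
have [y0|y0] := posnP y.
  by have -> : y = ord0 by apply: val_inj.
have yu : y != u by apply: contraNneq hy => ->.
have hp : ~~ anc 1 h u (p y) by apply: contra hy => hy; rewrite anc_p // hy orbT.
have py := p_lt y0; apply: connect_trans (connect1 (r_edge y0 yu)) (IH _ _ hp); lia.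
Qed.

Lemma side_child : side (tree n h) [set u; p u] u = sz 1 h u.
Proof.
rewrite /side /sz sh add1n big_mkord -sum1_card big_mkcond /=; apply: eq_bigr => y _.
rewrite inE -/r; case: (boolP (anc 1 h u y)) => hy; first by rewrite below.
by rewrite ifN //; apply: contra hy => /connect_anc <-.
Qed.

Lemma side_parent : side (tree n h) [set u; p u] (p u) = (n.+1 - sz 1 h u)%N.
Proof.
have nanc : ~~ anc 1 h u (p u).
  by apply/negP => /(anc_range wh)[_]; have := p_lt u0; lia.
rewrite -side_child /side -[X in (X - _)%N](card_ord n.+1) -(cardC [pred y | connect r u y]) addKn.
apply: eq_card => y; rewrite !inE -/r; apply/idP/idP.
  move=> /connect_anc e; apply/negP => /connect_anc; rewrite anc_uu -e => e'.
  by rewrite -e' in nanc.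
move=> ny; apply: (connect_trans (above nanc)).
rewrite (sym_connect_sym r_sym); apply: above.
by apply: contra ny; exact: below.
Qed.

End Edge.

Lemma edgesum_tree (R : realFieldType) k :
  edgesum R k (tree n h) = \sum_(1 <= u < 1 + n)
    (1 - (miss R k n.+1 (sz 1 h u) + miss R k n.+1 (n.+1 - sz 1 h u))).
Proof.
rewrite /edgesum {2}/tree big_imset /=; last first.
  by move=> v w; rewrite !inE; exact: edge_inj.
rewrite add1n [RHS]big_add1 /= big_mkord big_mkcond big_ord_recl /= inE /= add0r.
apply: eq_bigr => i _; rewrite inE /=; set v := lift ord0 i.
have v0 : (0 < v)%N by [].
rewrite big_setU1 /=; last first.
  by rewrite inE; apply/eqP => e; have := p_lt v0; rewrite /p -e ltnn.
by rewrite big_set1 side_child // side_parent.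
Qed.

End Build.

(** * Laws of labeled and unlabeled trees *)

Section Laws.
Variable R : realType.

Definition lexp (T : finType) (p : law R T) (F : T -> R) : R := \sum_x p x * F x.

Lemma lexp_ret (T : finType) (x : T) F : lexp (lret R x) F = F x.
Proof.
rewrite /lexp (bigD1 x) //= ffunE eqxx mul1r big1 ?addr0 // => y yx.
by rewrite ffunE (negPf yx) mul0r.
Qed.

Lemma lexp_bind (S T : finType) (p : law R S) (k : S -> law R T) F :
  lexp (lbind p k) F = lexp p (fun x => lexp (k x) F).
Proof.
rewrite /lexp; under eq_bigr do rewrite ffunE mulr_suml.
rewrite exchange_big /=; apply: eq_bigr => x _; rewrite mulr_sumr.
by apply: eq_bigr => y _; rewrite mulrA.
Qed.

Lemma lexp_map (S T : finType) (f : S -> T) (p : law R S) F :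
  lexp (lmap f p) F = lexp p (fun x => F (f x)).
Proof. by rewrite lexp_bind; apply: eq_bigr => x _; rewrite lexp_ret. Qed.

Lemma lexp_unif m F : lexp (lunif R 'I_m.+1) F = avg m.+1 (fun i => F (inord i)).
Proof.
rewrite /lexp /avg big_mkord mulr_sumr; apply: eq_bigr => i _.
by rewrite ffunE card_ord inord_val.
Qed.

Lemma lexp_mix (T : finType) a (p q : law R T) F :
  lexp (lmix a p q) F = a * lexp p F + (1 - a) * lexp q F.
Proof.
rewrite /lexp !mulr_sumr -big_split /=; apply: eq_bigr => x _.
by rewrite ffunE mulrDl !mulrA.
Qed.

Lemma lexp_prod (S T : finType) (p : law R S) (q : law R T) F :
  lexp (lprod p q) F = lexp p (fun x => lexp q (fun y => F (x, y))).
Proof.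
rewrite /lexp [RHS](eq_bigr (fun x => \sum_y p x * (q y * F (x, y)))).
  by rewrite pair_bigA /=; apply: eq_bigr => -[x y] _; rewrite ffunE mulrA.
by move=> x _; rewrite mulr_sumr.
Qed.

Lemma lexp_exchange (S T : finType) (p : law R S) (q : law R T) F :
  lexp p (fun x => lexp q (fun y => F x y)) = lexp q (fun y => lexp p (fun x => F x y)).
Proof.
rewrite /lexp; under eq_bigr do rewrite mulr_sumr.
rewrite exchange_big /=; apply: eq_bigr => y _; rewrite mulr_sumr.
by apply: eq_bigr => x _; rewrite mulrCA.
Qed.

Lemma lexp_ext (T : finType) (p q : law R T) : (forall F, lexp p F = lexp q F) -> p = q.
Proof.
have pt (r : law R T) y : r y = lexp r (fun x => (x == y)%:R).
  rewrite /lexp (bigD1 y) //= eqxx mulr1 big1 ?addr0 // => x xy.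
  by rewrite (negPf xy) mulr0.
by move=> pq; apply/ffunP => y; rewrite !pt pq.
Qed.

Lemma lprobE (T : finType) (p : law R T) (A : {set T}) :
  lprob p A = lexp p (fun x => (x \in A)%:R).
Proof.
rewrite /lprob big_mkcond; apply: eq_bigr => x _.
by case: (x \in A); rewrite ?mulr1 ?mulr0.
Qed.

Lemma labeled_CUA0 n : labeled_CUA (0 : R) n = lprod (labeled_UA R n) (labeled_UA R n).
Proof.
apply: lexp_ext; elim: n => [|n IH] F; first by rewrite lexp_prod !lexp_ret.
rewrite /= lexp_bind IH !lexp_prod lexp_bind; apply: eq_bigr => G _; congr (_ * _).
(* The correlated law draws both trees before both choices, the product law completes the first tree
   before drawing the second; the two orders are exchanged by Fubini. *)
transitivity (lexp (labeled_UA R n) (fun H => lexp (lunif R 'I_n.+1) (fun i =>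
   lexp (lunif R 'I_n.+1) (fun j => F (attach G i, attach H j))))).
  apply: eq_bigr => H _; congr (_ * _).
  rewrite lexp_mix mul0r add0r subr0 mul1r lexp_bind.
  apply: eq_bigr => i _; congr (_ * _); rewrite lexp_bind.
  by apply: eq_bigr => j _; rewrite lexp_ret.
rewrite lexp_exchange lexp_bind; apply: eq_bigr => i _; congr (_ * _).
rewrite lexp_ret lexp_bind; apply: eq_bigr => H _; congr (_ * _).
by rewrite lexp_bind; apply: eq_bigr => j _; rewrite lexp_ret.
Qed.

Lemma UA_prod n : lprod (UA R n) (UA R n) = CUA (0 : R) n.
Proof.
apply: lexp_ext => F; rewrite lexp_prod !lexp_map labeled_CUA0 lexp_prod.
by apply: eq_bigr => x _; rewrite lexp_map.
Qed.

Lemma lexp_labeled_CUA alpha n F : 0 <= alpha <= 1 ->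
  lexp (labeled_CUA alpha n) F
  = E2 alpha 1 n (fun h => F (tree n (unzip1 h), tree n (unzip2 h))).
Proof.
move=> a01; elim: n F => [|n IH] F.
  rewrite lexp_ret /=; congr (F (_, _)); apply/finset.setP => A.
    by rewrite finset.in_set0; apply/esym/imsetP => -[v]; rewrite inE (ord1 v).
  by rewrite finset.in_set0; apply/esym/imsetP => -[v]; rewrite inE (ord1 v).
rewrite [LHS]lexp_bind IH; have h2 := E2_expectation n a01 (isT : (0 < 1)%N).
rewrite [RHS]/=; apply: (exp_eq h2) => h [w1 w2 sh].
have s1 : size (unzip1 h) = n by rewrite size_map.
have s2 : size (unzip2 h) = n by rewrite size_map.
have hm := avg_expectation R (isT : (0 < n.+1)%N).
rewrite lexp_mix /avg2 !lexp_bind !lexp_unif add1n; congr (_ * _ + _ * _).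
  by apply: (exp_eq hm) => i hi; rewrite lexp_ret !attach_tree //= inordK.
apply: (exp_eq hm) => i hi; rewrite lexp_bind lexp_unif.
by apply: (exp_eq hm) => j hj; rewrite lexp_ret !attach_tree //= !inordK.
Qed.

Lemma lprob_CUA (alpha : R) n (A : {set ({set graph n.+1} * {set graph n.+1})%type}) :
  0 <= alpha <= 1 ->
  lprob (CUA alpha n) A = E2 alpha 1 n (fun h =>
    ((unlabeled (tree n (unzip1 h)), unlabeled (tree n (unzip2 h))) \in A)%:R).
Proof. by move=> a01; rewrite lprobE lexp_map lexp_labeled_CUA. Qed.

Lemma TV_ge (T : finType) (p q : law R T) A : lprob p A - lprob q A <= TV p q.
Proof.
apply: (le_trans (ler_norm _)); apply: ub_le_sup; last by exists A.
exists (\sum_A `|lprob p A - lprob q A|) => _ [B _ <-].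
by rewrite (bigD1 B) //= lerDl sumr_ge0.
Qed.

Lemma TV_le1 (T : finType) (p q : law R T) :
  (forall A, 0 <= lprob p A <= 1) -> (forall A, 0 <= lprob q A <= 1) -> TV p q <= 1.
Proof.
move=> hp hq; apply: ge_sup; first by exists `|lprob p finset.set0 - lprob q finset.set0|, finset.set0.
move=> _ [A _ <-]; rewrite ler_norml.
by have /andP[? ?] := hp A; have /andP[? ?] := hq A; apply/andP; split; lra.
Qed.

End Laws.

(** * Reading the martingale from the final tree *)

(** The process has [b] nodes after [b - 1] choices; the window holds the [d] choices that
    follow. *)
Definition window (T : Type) (b d : nat) (h : seq T) : seq T :=
  take d (past (b.-1 + d) h).

Section Windows.
Variable T : Type.
Implicit Types (h : seq T).

Lemma size_past r h : (r <= size h)%N -> size (past r h) = r.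
Proof. by move=> rh; rewrite /past size_drop subKn. Qed.

Lemma past_cat r h h0 : (r <= size h0)%N -> past r (h ++ h0) = past r h0.
Proof.
move=> rh; rewrite /past size_cat drop_cat ifF; last by lia.
by congr (drop _ _); lia.
Qed.

Lemma past_past r q h : (r <= q <= size h)%N -> past r (past q h) = past r h.
Proof.
move=> /andP[rq qh]; rewrite {1}/past size_past // /past drop_drop.
by congr (drop _ _); lia.
Qed.

Lemma window_past b d q h : (b.-1 + d <= q <= size h)%N ->
  window b d (past q h) = window b d h.
Proof. by move=> hq; rewrite /window past_past. Qed.

Lemma window_cat b d h h0 : (b.-1 + d <= size h0)%N ->
  window b d (h ++ h0) = window b d h0.
Proof. by move=> hb; rewrite /window past_cat. Qed.

Lemma window_top b d h h0 : size h = d -> size h0 = b.-1 -> window b d (h ++ h0) = h.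
Proof.
move=> sh s0; rewrite /window /past size_cat sh s0 addnC subnn drop0.
by rewrite take_cat sh ltnn subnn take0 cats0.
Qed.

End Windows.

Lemma map_window (T U : Type) (f : T -> U) b d h :
  map f (window b d h) = window b d (map f h).
Proof. by rewrite /window /past map_take map_drop size_map. Qed.

Section Approximation.
Variable R : realType.

Lemma E2_past (alpha : R) n r F : 0 <= alpha <= 1 -> (r <= n)%N ->
  E2 alpha 1 n (fun h => F (past r h)) = E2 alpha 1 r F.
Proof.
move=> a01 rn; rewrite -{1}(subnK rn) E2_cat.
have h1 := E2_expectation r a01 (isT : (0 < 1)%N).
apply: (exp_eq h1) => h0 [_ _ s0].
have h2 := E2_expectation (n - r) a01 (isT : (0 < 1 + r)%N).
rewrite -[RHS](exp_cst h2); apply: (exp_eq h2) => h _.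
by rewrite past_cat ?s0 // -{1}s0 past_size.
Qed.

(** Choices are independent of the tree they act on, so the first [b - 1] of them integrate out. *)
Lemma E2_window (alpha : R) b d F : 0 <= alpha <= 1 -> (0 < b)%N ->
  E2 alpha 1 (b.-1 + d) (fun h => F (window b d h)) = E2 alpha b d F.
Proof.
move=> a01 b0; rewrite addnC E2_cat add1n prednK //.
have h1 := E2_expectation b.-1 a01 (isT : (0 < 1)%N).
rewrite -[RHS](exp_cst h1); apply: (exp_eq h1) => h0 [_ _ s0].
have h2 := E2_expectation d a01 b0.
by apply: (exp_eq h2) => h [_ _ sh]; rewrite window_top.
Qed.

Lemma E1_window b d n (F : seq nat -> R) : (0 < b)%N -> (b.-1 + d <= n)%N ->
  E1 1 n (fun h => F (window b d h)) = E1 b d F.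
Proof.
move=> b0 hn; have a01 : 0 <= (0 : R) <= 1 by rewrite lexx ler01.
rewrite -(E2_fst 0 n (fun h => F (window b d h))) // -(E2_fst 0 d F) //.
rewrite -(E2_window _ _ a01 b0) -(E2_past _ a01 hn).
have h2 := E2_expectation n a01 (isT : (0 < 1)%N).
apply: (exp_eq h2) => h [_ _ sh]; rewrite window_past ?sh ?hn ?leqnn //.
by congr (F _); exact/esym/map_window.
Qed.

Definition centre k n : R := \sum_(1 <= u < 1 + n) k%:R / (u + k)%:R.

(* Expected number of nodes whose subtree receives all of the next [k] nodes: the
   price for not knowing which side of an edge contains the root. *)
Definition corr k n h : R :=
  \sum_(1 <= u < 1 + n) miss R k n.+1 (n.+1 - sz 1 h u).

Lemma edgesum_mart k n h : wf 1 h -> size h = n ->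
  edgesum R k (tree n h) - centre k n = mart R k 1 h - corr k n h.
Proof.
move=> wh sh; rewrite edgesum_tree // /centre /mart /corr sh -!sumrB.
by apply: eq_bigr => u _; rewrite add1n; ring.
Qed.

(** In the square, bound the factor of smaller label by 1: label [w] then carries weight [2 w]. By
    [E1_rise3] the means are at most [12 / ((w + 1) (w + 2))], which telescopes to at most 6. *)
Lemma E1_corr_sqr k n : (2 < k)%N -> E1 1 n (fun h => corr k n h ^+ 2) <= 6.
Proof.
move=> k2; have h1 := E1_expectation R n (isT : (0 < 1)%N).
apply: (le_trans (y := E1 1 n (fun h => \sum_(1 <= u < 1 + n)
    2 * u%:R * rise3 R n.+1 (sz 1 h u)))).
  apply: (exp_le h1) => h [wh sh].
  apply: (le_trans (sqr_sum_le _ _ _)) => [u|]; first exact: miss_ge0.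
  rewrite exchange_big mulr_sumr /=; apply: ler_sum_nat => w /andP[w1 wn].
  have m3 : miss R k n.+1 (n.+1 - sz 1 h w) <= rise3 R n.+1 (sz 1 h w).
    by apply: miss_compl => //; have := sz_le w wh; lia.
  rewrite -mulrA ler_wpM2l //; apply: le_trans (ler_wpM2l (ler0n _ w) m3).
  rewrite (big_cat_nat (n := w.+1)) //=.
  rewrite [X in _ + X]big_nat_cond [X in _ + X]big1 ?addr0; last first.
    by move=> u /andP[/andP[hu _] _]; rewrite leqNgt hu mul0r.
  have -> : w%:R * miss R k n.+1 (n.+1 - sz 1 h w)
    = \sum_(1 <= u < w.+1) miss R k n.+1 (n.+1 - sz 1 h w).
    by rewrite sumr_const_nat subn1 mulr_natl.
  apply: ler_sum_nat => u hu.
  by rewrite mulrA ler_piMl ?miss_ge0 // mulr_ile1 ?miss_ge0 ?miss_le1 ?lern1 ?leq_b1.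
rewrite (exp_sum h1).
apply: (le_trans (y := \sum_(1 <= u < 1 + n) (12 / u.+1%:R - 12 / u.+2%:R))).
  apply: ler_sum_nat => u /andP[u1 un].
  rewrite (expZ h1); have := @E1_rise3 R 1 n u isT; rewrite u1 un => /(_ isT) ->.
  rewrite !natrM -!(natr1 u) -(natr1 u.+1) -(natr1 u.+2) -(natr1 u.+1) -(natr1 u).
  have u0 : 0 <= u%:R :> R by [].
  move: (u%:R) u0 => x x0.
  have -> : 12 / (x + 1) - 12 / (x + 1 + 1) = 12 / ((x + 1) * (x + 1 + 1)) by field; nonzero.
  have -> : 2 * x * (6 / ((x + 1) * (x + 1 + 1) * (x + 1 + 1 + 1)))
    = 12 / ((x + 1) * (x + 1 + 1)) * (x / (x + 1 + 1 + 1)) by field; nonzero.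
  by rewrite ler_piMr ?divr_ge0 ?mulr_ge0 ?addr_ge0 // ler_pdivrMr; lra.
have -> : \sum_(1 <= u < 1 + n) (12 / u.+1%:R - 12 / u.+2%:R) = 12 / 2 - 12 / (n.+2)%:R :> R.
  elim: n {h1} => [|n IH]; first by rewrite big_geq // subrr.
  by rewrite addnS big_nat_recr //= IH add1n; ring.
have : 0 <= 12 / n.+2%:R :> R by rewrite divr_ge0.
by move: (12 / n.+2%:R) => z z0; lra.
Qed.

(** By [sz_cat] the two sums agree on labels at least [b]; the difference consists of [b - 1] terms
    in [[-1, 1]]. *)
Lemma mart_window k b d h : (0 < b)%N -> wf 1 h -> size h = (b.-1 + d)%N ->
  (mart R k 1 h - mart R k b (window b d h)) ^+ 2 <= b%:R ^+ 2.
Proof.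
move=> b0 wh sh.
set h2 := take d h; set h1 := drop d h.
have eh : h = h2 ++ h1 by rewrite cat_take_drop.
have s2 : size h2 = d by rewrite size_takel // sh leq_addl.
have s1 : size h1 = b.-1 by rewrite size_drop sh addnK.
have ew : window b d h = h2 by rewrite {1}eh window_top.
have bE : (1 + size h1 = b)%N by rewrite s1; lia.
have w1 : wf 1 h1 by move: wh; rewrite eh wf_cat => /andP[].
rewrite ew /mart (big_cat_nat (n := b)) /=; try lia.
rewrite sh s2 (_ : 1 + (b.-1 + d) = b + d)%N; last lia.
rewrite [X in _ + X - _](_ : _ = \sum_(b <= u < b + d)
   (1 - miss R k (b + d) (sz b h2 u) - k%:R / (u + k)%:R)); last first.
  by apply: eq_big_nat => u /andP[hu _]; rewrite eh sz_cat ?bE.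
rewrite addrK; set s := \sum_(_ <= _ < _) _.
have : `|s| <= \sum_(1 <= u < b) 1.
  apply: (le_trans (ler_norm_sum _ _ _)); apply: ler_sum => u _.
  have m0 := miss_ge0 R k (b + d) (sz 1 h u); have m1 := miss_le1 R k (b + d) (sz 1 h u).
  have k0 : 0 <= k%:R / (u + k)%:R :> R by rewrite divr_ge0.
  have k1 : k%:R / (u + k)%:R <= 1 :> R.
    have [->|uk] := eqVneq (u + k)%N 0%N; first by rewrite invr0 mulr0.
    by rewrite ler_pdivrMr ?mul1r ?ler_nat ?ltr0n; lia.
  rewrite ler_norml; lra.
rewrite sumr_const_nat => hs; rewrite -[s ^+ 2]real_normK ?num_real //.
rewrite ler_sqr ?nnegrE //; apply: (le_trans hs); rewrite ler_nat; lia.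
Qed.

Definition edgestat k n h : R := edgesum R k (tree n h) - centre k n.

(** Three errors: the unknown root side ([corr]), the choices after the window ([E1_mart_tail]) and
    the nodes born before it ([mart_window]). The factor 3 comes from squaring a sum of three
    terms. *)
Lemma E1_edgestat k b d n : (2 < k)%N -> (0 < b)%N -> (b.-1 + d <= n)%N ->
  E1 1 n (fun h => (edgestat k n h - mart R k b (window b d h)) ^+ 2)
  <= 3 * (6 + 24 * k%:R * Num.sqrt k%:R * isqrt R (b + d + k.-1) + b%:R ^+ 2).
Proof.
move=> k2 b0 hn; have h1 := E1_expectation R n (isT : (0 < 1)%N).
have k0 : (0 < k)%N by lia.
set r := (b.-1 + d)%N.
apply: (le_trans (y := 3 * (E1 1 n (fun h => corr k n h ^+ 2)
   + E1 1 n (fun h => (mart R k 1 h - mart R k 1 (past r h)) ^+ 2) + b%:R ^+ 2))).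
  rewrite -(expD h1) -[X in _ + X](exp_cst h1) -(expD h1) -(expZ h1).
  apply: (exp_le h1) => h [wh sh]; rewrite /edgestat edgesum_mart //.
  have wp : wf 1 (past r h).
    by move: wh; rewrite -{1}(cat_take_drop (size h - r) h) wf_cat => /andP[].
  have := mart_window k b0 wp _; rewrite size_past ?sh // => /(_ d erefl).
  rewrite window_past ?sh ?hn ?leqnn //.
  move: (corr _ _ _) (mart _ _ _ _) (mart _ _ _ _) (mart _ _ _ _) => c x y z.
  move=> H; have := sqr_ge0 (c + (x - z)); have := sqr_ge0 (c + (z - y)); have := sqr_ge0 ((x - z) - (z - y)).
  nra.
rewrite ler_wpM2l // lerD2r lerD ?E1_corr_sqr //.
apply: (le_trans (E1_mart_tail R (b := 1) (d := n) (r := r) k0 isT hn)).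
rewrite (_ : 1 + r + k.-1 = b + d + k.-1)%N; last by rewrite /r; lia.
rewrite ler_wpM2l ?mulr_ge0 ?sqrtr_ge0 // lerBlDr lerDl.
by rewrite invr_ge0 sqrtr_ge0.
Qed.

Lemma E1_mart_sqr_le k b d : (0 < k)%N -> (0 < b)%N ->
  E1 b d (fun h => mart R k b h ^+ 2) <= 24 * k%:R.
Proof.
move=> k0 b0; have h1 := E1_expectation R d b0.
have := E1_mart_tail R (d := d) (r := 0) k0 b0 (leq0n d).
have -> : E1 b d (fun h => (mart R k b h - mart R k b (past 0 h)) ^+ 2)
  = E1 b d (fun h => mart R k b h ^+ 2).
  apply: (exp_eq h1) => h _; rewrite /past subn0 drop_size.
  by rewrite [X in _ - X]big_geq ?subr0 //= addn0.
move=> H; apply: (le_trans H).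
rewrite -[leRHS]mulr1 -mulrA ler_wpM2l ?mulr_ge0 //.
have K0 : 0 < Num.sqrt k%:R :> R by rewrite sqrtr_gt0 ltr0n.
apply: (@le_trans _ _ (Num.sqrt k%:R * isqrt R (b + 0 + k.-1))).
  by rewrite ler_wpM2l ?sqrtr_ge0 // lerBlDr lerDl invr_ge0 sqrtr_ge0.
rewrite ler_pdivrMr ?mul1r ?sqrtr_gt0 ?ltr0n; last lia.
by rewrite ler_wsqrtr // ler_nat; lia.
Qed.

End Approximation.

(** * Separated scales *)

(** With [k] the scale, [b^2] is at most [k / g^2], so the nodes born before the window are
    negligible. A window of length [g^4 k] leaves a tail variance of order
    [k sqrt (k / (g^4 k)) = k / g^2]. *)
Definition scale (g b : nat) : nat := (400 * g ^ 2 * (b + 100) ^ 2)%N.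

Definition window_length (g b : nat) : nat := (g ^ 4 * scale g b)%N.

Fixpoint start (g l : nat) : nat :=
  if l is l'.+1 then (start g l' + window_length g (start g l'))%N else 1%N.

Section Scales.
Variable R : realType.
Variable g : nat.
Hypothesis g1 : (1 < g)%N.

Let k l := scale g (start g l).
Let b l := start g l.
Let d l := window_length g (start g l).

Lemma start_gt0 l : (0 < start g l)%N.
Proof. by elim: l => //= l IH; lia. Qed.

Lemma start_le l m : (l <= m)%N -> (start g l <= start g m)%N.
Proof.
elim: m => [|m IH] lm; first by have -> : l = 0%N by lia.
have [->//|ne] := eqVneq l m.+1.
by have /= := IH ltac:(lia); lia.
Qed.

Lemma window_start l m : (l < m)%N -> ((b l).-1 + d l <= (b m).-1)%N.
Proof. by move=> /start_le /=; have := start_gt0 l; rewrite /b /d; lia. Qed.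

Lemma scale_ge l : (400 * (b l + 100) <= k l)%N.
Proof.
rewrite /k /scale -/(b l) -mulnA leq_mul2l /=.
have : (0 < g ^ 2)%N by rewrite expn_gt0; lia.
by move: (g ^ 2)%N => q q0; rewrite expnS expn1; nia.
Qed.

Lemma scale_gt2 l : (2 < k l)%N.
Proof. by have := scale_ge l; lia. Qed.

Lemma length_ge l : (2 * k l <= b l + d l)%N.
Proof.
rewrite /d /window_length -/(k l).
have : (2 ^ 4 <= g ^ 4)%N by rewrite leq_exp2r.
by move: (g ^ 4)%N => q q0; nia.
Qed.

Definition signal K (h : seq (nat * nat)) : R :=
  \sum_(0 <= l < K) mart2 R (k l) (b l) (window (b l) (d l) h) / (k l)%:R.

Definition statistic n K (h : seq (nat * nat)) : R :=
  \sum_(0 <= l < K)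
    edgestat R (k l) n (unzip1 h) * edgestat R (k l) n (unzip2 h) / (k l)%:R.

Variable alpha : R.
Hypothesis a01 : 0 <= alpha <= 1.

Definition signal_mean K : R :=
  \sum_(0 <= l < K) E2 alpha (b l) (d l) (mart2 R (k l) (b l)) / (k l)%:R.

Lemma k_gt0 l : 0 < (k l)%:R :> R.
Proof. by rewrite ltr0n; have := scale_gt2 l; lia. Qed.

Lemma signal_mean_ge K : alpha * rate R * K%:R <= signal_mean K.
Proof.
have -> : alpha * rate R * K%:R = \sum_(0 <= l < K) (alpha * rate R).
  by rewrite sumr_const_nat subn0 mulr_natr.
apply: ler_sum => l _.
rewrite ler_pdivlMr ?k_gt0 // -mulrA.
by apply: E2_mart2_ge => //; [exact: start_gt0|exact: scale_ge|exact: length_ge].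
Qed.

(* Distinct windows use disjoint sets of attachment choices. *)
Lemma signal_var K :
  E2 alpha 1 (b K).-1 (fun h => (signal K h - signal_mean K) ^+ 2)
  <= K%:R * (7 * (g ^ 8)%:R).
Proof.
elim: K => [|K IH].
  by rewrite /= /signal /signal_mean !big_geq // subrr expr0n mul0r.
have -> : (b K.+1).-1 = (d K + (b K).-1)%N by rewrite /b /d /=; have := start_gt0 K; lia.
have b0 : (0 < b K)%N by exact: start_gt0.
rewrite E2_cat add1n prednK //.
have h1 := E2_expectation (b K).-1 a01 (isT : (0 < 1)%N).
have h2 := E2_expectation (d K) a01 b0.
rewrite -natr1 mulrDl mul1r -[X in _ + X](exp_cst h1).
apply: (le_trans _ (lerD IH (lexx _))); rewrite -(expD h1).
apply: (exp_le h1) => h0 [_ _ s0].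
set x := signal K h0 - signal_mean K.
pose z h := mart2 R (k K) (b K) h / (k K)%:R.
have Ez : E2 alpha (b K) (d K) z = E2 alpha (b K) (d K) (mart2 R (k K) (b K)) / (k K)%:R.
  rewrite mulrC -(expZ h2); apply: (exp_eq h2) => h _; by rewrite mulrC.
rewrite (exp_eq h2 (g := fun h => x ^+ 2 + (2 * x * (z h - E2 alpha (b K) (d K) z)
    + (z h - E2 alpha (b K) (d K) z) ^+ 2))); last first.
  move=> h [_ _ sh]; rewrite /signal /signal_mean !big_nat_recr //= -Ez.
  rewrite window_top // -/(z h).
  have -> : \sum_(0 <= l < K) mart2 R (k l) (b l) (window (b l) (d l) (h ++ h0)) / (k l)%:R
    = signal K h0.
    apply: eq_big_nat => l /andP[_ lK]; rewrite window_cat // s0.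
    exact: window_start.
  by rewrite /x /signal_mean; ring.
(* Given the older choices [x] is constant, so the cross term has mean 0. *)
rewrite (expD h2) (exp_cst h2) (expD h2) (expZ h2) (expB h2) (exp_cst h2) subrr.
rewrite mulr0 add0r lerD2l (exp_var h2).
apply: (le_trans (y := E2 alpha (b K) (d K) (fun h => z h ^+ 2))).
  by rewrite lerBlDr lerDl sqr_ge0.
rewrite (exp_eq h2 (g := fun h => (k K)%:R^-1 ^+ 2 * mart2 R (k K) (b K) h ^+ 2)).
  rewrite (expZ h2); have k0 := k_gt0 K.
  apply: (le_trans (ler_wpM2l (sqr_ge0 _) (E2_mart2_sqr_le a01 (k K) (d K) b0))).
  (* The window has length [g^4 k], so [7 d^2 / k^2] equals [7 g^8]. *)
  have -> : (g ^ 8 = g ^ 4 * g ^ 4)%N by rewrite -expnD.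
  rewrite /d /window_length -/(k K) (natrM _ (g ^ 4) (k K)) (natrM _ (g ^ 4) (g ^ 4)) le_eqVlt; apply/orP; left; apply/eqP.
  by move: ((k K)%:R) ((g ^ 4)%:R) k0 => x' y' k0; field; nonzero.
by move=> h _; rewrite /z; ring.
Qed.

Lemma edgestat_error n K l : ((b K).-1 <= n)%N -> (l < K)%N ->
  E1 1 n (fun h => (edgestat R (k l) n h - mart R (k l) (b l) (window (b l) (d l) h)) ^+ 2)
  <= 100 * (k l)%:R / g%:R ^+ 2.
Proof.
move=> Kn lK; have wK := leq_trans (window_start lK) Kn.
apply: (le_trans (E1_edgestat R (scale_gt2 l) (start_gt0 l) wK)).
have g0 : 0 < g%:R :> R by rewrite ltr0n; lia.
have G0 : 0 < g%:R ^+ 2 :> R by rewrite exprn_gt0.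
have k0 := k_gt0 l.
have H1 : Num.sqrt (k l)%:R * isqrt R (b l + d l + (k l).-1) <= (g%:R ^+ 2)^-1.
  have y0 : (0 < b l + d l + (k l).-1)%N by have := start_gt0 l; rewrite -/(b l); lia.
  rewrite ler_pdivrMr ?sqrtr_gt0 ?ltr0n // mulrC ler_pdivlMr //.
  have -> : g%:R ^+ 2 = Num.sqrt (g ^ 4)%:R :> R.
    rewrite (_ : (g ^ 4)%:R = (g%:R ^+ 2) ^+ 2); last by rewrite natrX -exprM.
    by rewrite sqrtr_sqr ger0_norm // ltW.
  by rewrite -sqrtrM // -natrM ler_wsqrtr // ler_nat mulnC /d /window_length -/(k l); lia.
have H2 : 18 + 3 * (b l)%:R ^+ 2 <= (k l)%:R / g%:R ^+ 2 :> R.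
  rewrite /k /scale -/(b l) (natrM _ (400 * g ^ 2)%N) (natrM _ 400) (natrX _ g).
  rewrite [leRHS](_ : _ = 400 * ((b l + 100) ^ 2)%:R).
    by rewrite -natrX -!natrM -natrD ler_nat; nia.
  by move: ((_ ^ 2)%N) => m; field; nonzero.
have H3 : 24 * (k l)%:R * Num.sqrt (k l)%:R * isqrt R (b l + d l + (k l).-1)
  <= 24 * ((k l)%:R / g%:R ^+ 2) by rewrite -!mulrA ler_wpM2l // ler_wpM2l // ltW.
rewrite -[leRHS]mulrA; move: (_ / g%:R ^+ 2) H2 H3 => q; set y := isqrt R _.
have b0 : 0 <= (b l)%:R ^+ 2 :> R by exact: sqr_ge0.
by move: (24 * _ * _ * _) => z H2 H3; lra.
Qed.

Lemma statistic_error n K : ((b K).-1 <= n)%N ->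
  E2 alpha 1 n (fun h => `|statistic n K h - signal K h|) <= K%:R * (225 / g%:R).
Proof.
move=> Kn; have h2 := E2_expectation n a01 (isT : (0 < 1)%N).
have g0 : 0 < g%:R :> R by rewrite ltr0n; lia.
pose X l h := edgestat R (k l) n h.
pose M l h := mart R (k l) (b l) (window (b l) (d l) h).
(* Products are compared by Young's inequality with weight [g]: the squared error has mean of order
   [k / g^2] and the squared martingale of order [k], so both parts of [B] are of order [k / g]. *)
pose B l h : R := (g%:R + 1) / 2 * (X l h - M l h) ^+ 2 + (2 * g%:R)^-1 * M l h ^+ 2.
apply: (le_trans (y := E2 alpha 1 n (fun h => \sum_(0 <= l < K)
    (k l)%:R^-1 * (B l (unzip1 h) + B l (unzip2 h))))).
  apply: (exp_le h2) => h _; rewrite /statistic /signal -sumrB.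
  apply: (le_trans (ler_norm_sum _ _ _)); apply: ler_sum => l _.
  rewrite /mart2 [unzip1 (window _ _ _)]map_window [unzip2 (window _ _ _)]map_window.
  rewrite -/(X l _) -/(X l _) -/(M l _) -/(M l _) -mulrBl normrM mulrC.
  rewrite (ger0_norm (_ : 0 <= (k l)%:R^-1)) ?invr_ge0 // ler_wpM2l ?invr_ge0 //.
  rewrite /B -/(unzip1 h) -/(unzip2 h).
  move: (X l _) (M l _) (X l _) (M l _) => x' m' x m.
  have -> : x * x' - m * m' = (x - m) * m' + m * (x' - m') + (x - m) * (x' - m') by ring.
  move: (x - m) (x' - m') => e e'.
  have Q (u v : R) : `|u * v| <= 2^-1 * (u ^+ 2 + v ^+ 2).
    rewrite ler_norml; have := sqr_ge0 (u - v); have := sqr_ge0 (u + v); nra.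
  have P (u v : R) : `|u * v| <= 2^-1 * (g%:R * u ^+ 2 + g%:R^-1 * v ^+ 2).
    have -> : 2^-1 * (g%:R * u ^+ 2 + g%:R^-1 * v ^+ 2)
      = 2^-1 * g%:R * (u ^+ 2 + (v / g%:R) ^+ 2) by field; nonzero.
    have -> : u * v = g%:R * (u * (v / g%:R)) by field; nonzero.
    rewrite normrM gtr0_norm //; move: (v / _) => w.
    by rewrite -mulrA mulrCA ler_wpM2l ?(ltW g0).
  apply: (le_trans (ler_normD _ _)); apply: (le_trans (lerD (ler_normD _ _) (lexx _))).
  apply: (le_trans (lerD (lerD (P e m') _) (Q e e'))); first by rewrite mulrC; exact: P.
  rewrite invfM le_eqVlt; apply/orP; left; apply/eqP.
  by move: (g%:R) (g%:R^-1) => u v; field.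
rewrite (exp_sum h2).
have -> : K%:R * (225 / g%:R) = \sum_(0 <= l < K) (225 / g%:R) :> R.
  by rewrite sumr_const_nat subn0 mulr_natl.
apply: ler_sum_nat => l /andP[_ lK].
rewrite (expZ h2) (expD h2) (E2_fst alpha n (B l)) // (E2_snd alpha n (B l)) //.
have h1 := E1_expectation R n (isT : (0 < 1)%N).
have k0 := k_gt0 l.
have wK := leq_trans (window_start lK) Kn.
have EB : E1 1 n (B l) <= (k l)%:R * (112 / g%:R).
  rewrite (expD h1) !(expZ h1).
  have HX := edgestat_error Kn lK; rewrite -/(X l _) -/(M l _) in HX.
  have HM : E1 1 n (fun h => M l h ^+ 2) <= 24 * (k l)%:R.
    rewrite (E1_window (fun h => mart R (k l) (b l) h ^+ 2) (start_gt0 l) wK).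
    by apply: E1_mart_sqr_le; [have := scale_gt2 l; lia|exact: start_gt0].
  have c1 : 0 <= (g%:R + 1) / 2 :> R by rewrite divr_ge0 ?addr_ge0 // ltW.
  have c2 : 0 <= (2 * g%:R)^-1 :> R by rewrite invr_ge0 mulr_ge0 // ltW.
  apply: (le_trans (lerD (ler_wpM2l c1 HX) (ler_wpM2l c2 HM))).
  have -> : (g%:R + 1) / 2 * (100 * (k l)%:R / g%:R ^+ 2) + (2 * g%:R)^-1 * (24 * (k l)%:R)
    = (k l)%:R * ((62 + 50 / g%:R) / g%:R) :> R by field; nonzero.
  rewrite ler_wpM2l ?(ltW k0) // ler_wpM2r ?invr_ge0 ?(ltW g0) //.
  have : g%:R^-1 <= 1 :> R by rewrite invf_le1 // ler1n; lia.
  lra.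
rewrite mulrC ler_pdivrMr //; apply: (le_trans (lerD EB EB)).
have -> : 225 / g%:R * (k l)%:R = (k l)%:R * (225 / g%:R) :> R by rewrite mulrC.
rewrite -mulrDr ler_wpM2l ?(ltW k0) // -mulrDl ler_wpM2r ?invr_ge0 ?(ltW g0) //; lra.
Qed.

Lemma deviation n K (t : R) : 0 < t -> ((b K).-1 <= n)%N ->
  E2 alpha 1 n (fun h => t^-1 * `|statistic n K h - signal K h|
     + t^-1 ^+ 2 * (signal K h - signal_mean K) ^+ 2)
  <= t^-1 * (K%:R * (225 / g%:R)) + t^-1 ^+ 2 * (K%:R * (7 * (g ^ 8)%:R)).
Proof.
move=> t0 Kn; have h2 := E2_expectation n a01 (isT : (0 < 1)%N).
rewrite (expD h2) !(expZ h2) lerD //.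
  by rewrite ler_wpM2l ?invr_ge0 ?(ltW t0) // statistic_error.
rewrite ler_wpM2l ?sqr_ge0 //; apply: le_trans (signal_var K).
rewrite -(E2_past _ a01 Kn) le_eqVlt; apply/orP; left; apply/eqP.
apply: (exp_eq h2) => h [_ _ sh]; congr ((_ - _) ^+ 2).
apply: eq_big_nat => l /andP[_ lK].
by rewrite window_past // sh Kn window_start.
Qed.

(** Markov for [x - y] and Chebyshev for [y - m] in one pointwise bound: one of the two deviations
    is at least [t / 2]. *)
Lemma deviation_ind (x y m t : R) : 0 < t -> t <= `|x - m| ->
  1 <= (t / 2)^-1 * `|x - y| + (t / 2)^-1 ^+ 2 * (y - m) ^+ 2.
Proof.
move=> t0 tx; set s := t / 2; have s0 : 0 < s by rewrite divr_gt0.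
have st : s + s = t by rewrite /s; field.
clearbody s.
have [xy|yx] := lerP s `|x - y|.
  rewrite -[leLHS]addr0; apply: lerD; last by apply: mulr_ge0; exact: sqr_ge0.
  by rewrite mulrC ler_pdivlMr ?mul1r.
have ym : s <= `|y - m|.
  have := ler_normD (x - y) (y - m); rewrite addrA subrK => H.
  lra.
rewrite -[leLHS]add0r; apply: lerD; first by rewrite mulr_ge0 ?invr_ge0 ?(ltW s0).
rewrite -exprMn -[X in _ <= X](real_normK (num_real _)) normrM gtr0_norm ?invr_gt0 //.
by rewrite -[leLHS](expr1n _ 2) ler_sqr ?nnegrE ?mulr_ge0 ?invr_ge0 ?(ltW s0) // mulrC ler_pdivlMr ?mul1r.
Qed.

End Scales.

(** * The test *)

Section Test.
Variable R : realType.

Definition class_statistic (g K n : nat) (U : {set graph n.+1} * {set graph n.+1}) : R :=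
  \sum_(0 <= l < K)
    (edgesum_class R (scale g (start g l)) U.1 - centre R (scale g (start g l)) n)
    * (edgesum_class R (scale g (start g l)) U.2 - centre R (scale g (start g l)) n)
    / (scale g (start g l))%:R.

Definition test (g K n : nat) (t : R) : {set ({set graph n.+1} * {set graph n.+1})%type} :=
  [set U | t < class_statistic g K U].

Lemma lprob_test (alpha : R) g K n t : 0 <= alpha <= 1 ->
  lprob (CUA alpha n) (test g K n t)
  = E2 alpha 1 n (fun h => (t < statistic R g n K h)%R%:R).
Proof.
move=> a01; rewrite lprob_CUA //.
apply: (exp_eq (E2_expectation n a01 (isT : (0 < 1)%N))) => h _.
by rewrite inE /class_statistic /=; congr ((_ < _)%R%:R); apply: eq_bigr => l _;
  rewrite !edgesum_classE.
Qed.

Lemma lprob_CUA_bounds (alpha : R) n A : 0 <= alpha <= 1 -> 0 <= lprob (CUA alpha n) A <= 1.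
Proof.
move=> a01; have h2 := E2_expectation n a01 (isT : (0 < 1)%N).
rewrite lprob_CUA //; apply/andP; split; first exact: (exp_ge0 h2).
by rewrite -[leRHS](exp_cst h2); apply: (exp_le h2) => h _; rewrite lern1 leq_b1.
Qed.

(** The bound of [deviation] at threshold [delta K / 4], a quarter of the lower bound on the mean
    signal. *)
Definition error (delta : R) (g K : nat) : R :=
  900 / (delta * g%:R) + 112 * (g ^ 8)%:R / (delta ^+ 2 * K%:R).

Lemma TV_separation (alpha : R) g K n : 0 < alpha -> alpha <= 1 -> (1 < g)%N ->
  (0 < K)%N -> ((start g K).-1 <= n)%N ->
  1 - 2 * error (alpha * rate R) g K <= TV (CUA alpha n) (CUA (0 : R) n).
Proof.
move=> a0 a1 g1 K0 Kn; set delta := alpha * rate R.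
have g0 : 0 < g%:R :> R by rewrite ltr0n; lia.
have K0' : 0 < K%:R :> R by rewrite ltr0n.
have d0 : 0 < delta by rewrite mulr_gt0 // rate_gt0.
have a01 : 0 <= alpha <= 1 by apply/andP; split=> //; exact: ltW.
have z01 : 0 <= (0 : R) <= 1 by rewrite lexx ler01.
have T0 : 0 < delta * K%:R by apply: mulr_gt0.
(* Halfway between 0, the mean signal under the product law, and [delta K], a lower bound for it
   under the correlated law. *)
pose t := delta * K%:R / 2; have t0 : 0 < t by apply: divr_gt0.
have h0 := E2_expectation n z01 (isT : (0 < 1)%N).
have ha := E2_expectation n a01 (isT : (0 < 1)%N).
have errE : (t / 2)^-1 * (K%:R * (225 / g%:R)) + (t / 2)^-1 ^+ 2 * (K%:R * (7 * (g ^ 8)%:R))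
    = error delta g K.
  by rewrite /error /t; move: ((g ^ 8)%:R) => G; field; nonzero.
have t20 : 0 < t / 2 by rewrite divr_gt0.
have dev_ge0 (x y : R) : 0 <= (t / 2)^-1 * `|x| + (t / 2)^-1 ^+ 2 * y ^+ 2.
  by apply: addr_ge0; apply: mulr_ge0; rewrite ?sqr_ge0 ?normr_ge0 ?invr_ge0 ?(ltW t20).
have Ha : 1 - lprob (CUA alpha n) (test g K n t) <= error delta g K.
  rewrite lprob_test // -[X in X - _](exp_cst ha) -(expB ha) -errE.
  apply: le_trans (deviation g1 a01 t20 Kn); apply: (exp_le ha) => h _.
  have [_|st] := ltP t _; first by rewrite subrr.
  rewrite subr0; apply: deviation_ind => //.
  have mean : 2 * t <= signal_mean g alpha K.
    have -> : 2 * t = delta * K%:R by rewrite /t; field.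
    exact: signal_mean_ge.
  by rewrite distrC; apply: le_trans (ler_norm _); lra.
have Hz : lprob (CUA (0 : R) n) (test g K n t) <= error delta g K.
  rewrite lprob_test // -errE.
  apply: le_trans (deviation g1 z01 t20 Kn); apply: (exp_le h0) => h _.
  have mean : signal_mean g 0 K = 0 :> R.
    by apply: big1 => l _; rewrite E2_mart2_indep ?mul0r // start_gt0.
  have [st|_] := ltP t _; last exact: dev_ge0.
  apply: deviation_ind => //.
  by rewrite mean subr0; apply: le_trans (ler_norm _); exact: ltW.
apply: le_trans (TV_ge _ _ (test g K n t)).
lra.
Qed.

Lemma natr_above (x : R) : exists2 n, (1 < n)%N & x <= n%:R.
Proof.
exists (Num.bound `|x|).+2 => //; apply: (le_trans (ler_norm x)).
apply: (le_trans (ltW (archi_boundP (normr_ge0 x)))).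
by rewrite ler_nat ltnW.
Qed.

Lemma error_small (delta e : R) : 0 < delta -> 0 < e ->
  exists g K, [/\ (1 < g)%N, (0 < K)%N & 2 * error delta g K <= e].
Proof.
move=> d0 e0; have de0 : 0 < delta * e by apply: mulr_gt0.
(* The separation [g] is fixed first; the number [K] of scales must then beat the factor [g^8]. Each
   of the two terms is made at most [e / 4]. *)
have [g g1 Hg] := natr_above (3600 / (delta * e)).
have D0 : 0 < delta ^+ 2 by apply: exprn_gt0.
have De0 : 0 < delta ^+ 2 * e by apply: mulr_gt0.
have [K K1 HK] := natr_above (448 * (g ^ 8)%:R / (delta ^+ 2 * e)).
exists g, K; split; [exact: g1|exact: ltnW|]; rewrite /error.
have x0 : 0 < g%:R :> R by rewrite ltr0n; apply: ltnW.
have y0 : 0 < K%:R :> R by rewrite ltr0n; apply: ltnW.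
move: ((g ^ 8)%:R) (g%:R) (K%:R) x0 y0 Hg HK => G x y x0 y0.
rewrite (ler_pdivrMr _ _ de0) (ler_pdivrMr _ _ De0) => Hg HK.
have H1 : 900 / (delta * x) <= e / 4.
  rewrite ler_pdivrMr; [lra|exact: mulr_gt0].
have H2 : 112 * G / (delta ^+ 2 * y) <= e / 4.
  rewrite ler_pdivrMr; [lra|exact: mulr_gt0].
lra.
Qed.

End Test.

Local Open Scope classical_set_scope.
Local Open Scope ring_scope.

Theorem theorem1p1 (R : realType) (alpha : R)
    (alpha_gt0 : 0 < alpha) (alpha_le1 : alpha <= 1) :
  TV (CUA alpha n) (lprod (UA R n) (UA R n)) @[n --> \oo] --> (1 : R).
Proof.
apply/cvgrPdist_le => e e0.
have d0 : 0 < alpha * rate R by rewrite mulr_gt0 // rate_gt0.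
have [g [K [g1 K0 err]]] := error_small d0 e0.
(* From this time on all [K] windows lie inside the history. *)
exists (start g K).-1 => //= n Kn; rewrite UA_prod.
have a01 : 0 <= alpha <= 1 by apply/andP; split=> //; exact: ltW.
have z01 : 0 <= (0 : R) <= 1 by rewrite lexx ler01.
have le1 : TV (CUA alpha n) (CUA (0 : R) n) <= 1.
  by apply: TV_le1 => A; exact: lprob_CUA_bounds.
rewrite ger0_norm ?subr_ge0 // lerBlDr -lerBlDl.
apply: le_trans (TV_separation alpha_gt0 alpha_le1 g1 K0 Kn).
lra.
Qed.
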